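(* For $z\in\mathbb{C}$, $w\in\mathbb{C}\setminus\{0\}$ and $|\arg x|<\frac{\pi}{4}$, $${}_1K_{z,w}(2x)=\frac{2x^{-z}}{w^2}\int_0^\infty u^{2z-1}e^{-u^2-x^2/u^2}\sin(wu)\sin\left(\frac{wx}{u}\right)du.$$
   Context: For $z,w\in\mathbb{C}$, $x\in\mathbb{C}\setminus(-\infty,0]$ and $c>-1\pm\mathrm{Re}(z)$, $${}_1K_{z,w}(x):=\frac{1}{2\pi i}\int_{c-i\infty}^{c+i\infty}\Gamma\left(\tfrac{1+s-z}{2}\right)\Gamma\left(\tfrac{1+s+z}{2}\right){}_1F_1\left(\tfrac{1+s-z}{2};\tfrac{3}{2};-\tfrac{w^2}{4}\right){}_1F_1\left(\tfrac{1+s+z}{2};\tfrac{3}{2};-\tfrac{w^2}{4}\right)2^{s-1}x^{-s}\,ds,$$ where ${}_1F_1$ is the confluent hypergeometric function. *)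

(* Defs.v *)
From HB Require Import structures.
From mathcomp Require Import all_boot all_order all_algebra.
From mathcomp Require Import all_classical all_reals all_analysis.
From mathcomp Require Import complex.

Set Implicit Arguments.
Unset Strict Implicit.
Unset Printing Implicit Defensive.

Import Order.TTheory GRing.Theory Num.Theory.
Import numFieldNormedType.Exports.

Local Open Scope classical_set_scope.
Local Open Scope ring_scope.
Local Open Scope complex_scope.

Section ComplexElementary.
Variable R : realType.
Implicit Types z s : R[i].

Definition cexp z : R[i] :=
  (expR (complex.Re z))%:C * (cos (complex.Im z) +i* sin (complex.Im z)).

Definition csin z : R[i] := (cexp ('i * z) - cexp (- 'i * z)) / (2 * 'i).

Definition cabs z : R := Num.sqrt (complex.Re z ^+ 2 + complex.Im z ^+ 2).

(* Principal argument, with values in ]-pi, pi]; meaningless at z = 0. *)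
Definition carg z : R :=
  if 0 <= complex.Im z then acos (complex.Re z / cabs z)
  else - acos (complex.Re z / cabs z).

Definition cln z : R[i] := ln (cabs z) +i* carg z.

(* Principal branch of z ^ s; meaningless at z = 0. *)
Definition cpow z s : R[i] := cexp (s * cln z).

End ComplexElementary.

Section ComplexIntegral.
Variable R : realType.
Implicit Types (D : set R) (f : R -> R[i]).

(* Absolutely convergent (Lebesgue) integrals of complex-valued functions of
   a real variable. Without cintegrable the value of cintegral is junk. *)
Definition cintegrable D f : Prop :=
  (@lebesgue_measure R).-integrable D (fun t => (complex.Re (f t))%:E) /\
  (@lebesgue_measure R).-integrable D (fun t => (complex.Im (f t))%:E).

Definition cintegral D f : R[i] :=
  (\int[@lebesgue_measure R]_(t in D) complex.Re (f t)) +i*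
  (\int[@lebesgue_measure R]_(t in D) complex.Im (f t)).

(* Integral of F(s) ds along the line s = c + i t, from c - i oo to c + i oo;
   the factor 'i comes from ds = i dt. *)
Definition vline_integrable (c : R) (F : R[i] -> R[i]) : Prop :=
  cintegrable setT (fun t => F (c +i* t)).

Definition vline_integral (c : R) (F : R[i] -> R[i]) : R[i] :=
  'i * cintegral setT (fun t => F (c +i* t)).

End ComplexIntegral.

Section SpecialFunctions.
Variable R : realType.

(* Euler's integral: the Gamma function on the half-plane 0 < Re s only. This
   suffices below: on the line Re s = c with c > -1 + Re z and c > -1 - Re z,
   both (1 + s - z) / 2 and (1 + s + z) / 2 have positive real part. *)
Definition cGamma (s : R[i]) : R[i] :=
  cintegral `]0, +oo[ (fun t => cpow t%:C (s - 1) * cexp (- t%:C)).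

Definition pochhammer (a : R[i]) (n : nat) : R[i] :=
  \prod_(0 <= k < n) (a + k%:R).

(* R[i] carries its topology through the alias R[i]^o. *)
Definition hyp1F1 (a b x : R[i]) : R[i] :=
  limn (series (fun n : nat =>
    pochhammer a n / pochhammer b n * x ^+ n / n`!%:R : (R[i])^o)).

Definition K1_integrand (z w x s : R[i]) : R[i] :=
  cGamma ((1 + s - z) / 2) * cGamma ((1 + s + z) / 2) *
  hyp1F1 ((1 + s - z) / 2) (3 / 2) (- (w ^+ 2 / 4)) *
  hyp1F1 ((1 + s + z) / 2) (3 / 2) (- (w ^+ 2 / 4)) *
  cpow 2 (s - 1) * cpow x (- s).

Definition K1 (c : R) (z w x : R[i]) : R[i] :=
  (2 * (pi : R)%:C * 'i)^-1 * vline_integral c (K1_integrand z w x).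

End SpecialFunctions.

(* Main.v *)
(* Write H(y) = exp(-exp(2y)) sin(w exp y).  Expanding the sine and integrating
   termwise gives, for Re s > -1 and |Im xi| < pi/4,
     int_R exp(s v) H(v + xi) dv
       = exp(-s xi) (w/2) Gamma((1+s)/2) 1F1((1+s)/2; 3/2; -w^2/4),
   where the factor exp(-s xi) comes from rotating the ray in Euler's integral.
   With xi = log x, the integrand of K on the line Re s = c is therefore, up to a
   constant, the product of the Fourier transforms of exp((c+z)v) H(v) and of
   exp((c-z)v) H(v + xi), and Parseval's identity turns its integral into
   2 pi int_R exp(2zv) H(v) H(xi - v) dv, which is the right-hand side under
   u = exp v.  Rotating slightly further than xi makes the second transform
   decay exponentially, which justifies Fourier inversion. *)

Require Import Defs.
From HB Require Import structures.
From mathcomp Require Import all_boot all_order all_algebra.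
From mathcomp Require Import all_classical all_reals all_analysis.
From mathcomp Require Import measurable_realfun complex.
From mathcomp Require Import ring lra.
Set Implicit Arguments.
Unset Strict Implicit.
Unset Printing Implicit Defensive.
Import Order.TTheory GRing.Theory Num.Theory.
Import numFieldNormedType.Exports.
Local Open Scope classical_set_scope.
Local Open Scope ring_scope.
Local Open Scope complex_scope.

(** * Complex elementary functions *)

Section ComplexBasics.
Variable R : realType.
Implicit Types (x y z : R[i]) (t : R).

(** No contour integral occurs. In the variable v = log t, Euler's integrand is the entire function
    [gline a], and turning the ray by an angle th means integrating along the line Im = th.
    Independence of th then comes from translation invariance of Lebesgue measure and a Taylor
    estimate that is uniform along the line. The same rotated integral, for a = 1, evaluates the
    half-line integral of exp(-lam t) and so yields the Poisson kernel on which Fourier inversion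
    rests.

    The sector |arg x| < pi/4 comes from |exp(-exp(2(v + xi)))| = exp(-exp(2(v + Re xi)) cos(2 Im
    xi)), which decays exactly when cos(2 Im xi) > 0. Strictness of the inequality leaves room for
    the additional rotation of the second transform.

    Nearly all majorants, for integrability, for dominated convergence and for Fubini, are multiples
    of the single Lorentzian [lor]. Complex notions are handled by components (derivatives,
    continuity, measurability, integrals), and complex limits as real limits of [cabs] of a
    difference. *)

Lemma Re_mul x y : complex.Re (x * y) =
  complex.Re x * complex.Re y - complex.Im x * complex.Im y.
Proof. by case: x y => a b [c d]. Qed.

Lemma Im_mul x y : complex.Im (x * y) =
  complex.Re x * complex.Im y + complex.Im x * complex.Re y.
Proof. by case: x y => a b [c d]. Qed.

Lemma Re_add x y : complex.Re (x + y) = complex.Re x + complex.Re y.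
Proof. by case: x y => a b [c d]. Qed.

Lemma Im_add x y : complex.Im (x + y) = complex.Im x + complex.Im y.
Proof. by case: x y => a b [c d]. Qed.

Lemma Re_opp x : complex.Re (- x) = - complex.Re x.
Proof. by case: x. Qed.

Lemma Im_opp x : complex.Im (- x) = - complex.Im x.
Proof. by case: x. Qed.

Lemma Re_real t : complex.Re t%:C = t. Proof. by []. Qed.

Lemma Im_real t : complex.Im t%:C = 0. Proof. by []. Qed.

Definition ReImE := (Re_add, Im_add, Re_opp, Im_opp, Re_mul, Im_mul,
  Re_real, Im_real).

Lemma complex_eq x y : complex.Re x = complex.Re y ->
  complex.Im x = complex.Im y -> x = y.
Proof. by case: x y => a b [c d] /= -> ->. Qed.

Lemma natC (n : nat) : n%:R = (n%:R : R)%:C.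
Proof. by rewrite rmorph_nat. Qed.

Lemma cabsE z : cabs z = Normc.normc z. Proof. by case: z. Qed.

Lemma cabs_norm z : `|z| = (cabs z)%:C. Proof. by case: z. Qed.

Lemma cabsM x y : cabs (x * y) = cabs x * cabs y.
Proof. by rewrite !cabsE Normc.normcM. Qed.

Lemma cabsV x : cabs x^-1 = (cabs x)^-1.
Proof. by rewrite !cabsE Normc.normcV. Qed.

Lemma cabsN x : cabs (- x) = cabs x.
Proof. by rewrite !cabsE normcN. Qed.

Lemma cabsX x n : cabs (x ^+ n) = cabs x ^+ n.
Proof. by apply: (@complexI R); rewrite -cabs_norm normrX cabs_norm rmorphXn. Qed.

Lemma cabs_ge0 x : 0 <= cabs x. Proof. exact: sqrtr_ge0. Qed.

Lemma ler_cabsD x y : cabs (x + y) <= cabs x + cabs y.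
Proof. by rewrite !cabsE le_normcD. Qed.

Lemma ler_cabsB x y : cabs (x - y) <= cabs x + cabs y.
Proof. by rewrite -(cabsN y) ler_cabsD. Qed.

Lemma cabs0 : cabs (0 : R[i]) = 0. Proof. by rewrite cabsE Normc.normc0. Qed.

Lemma cabs_eq0 x : (cabs x == 0) = (x == 0).
Proof.
apply/eqP/eqP => [|->]; last exact: cabs0.
by rewrite cabsE => /Normc.eq0_normc.
Qed.

Lemma cabs_gt0 x : (0 < cabs x) = (x != 0).
Proof. by rewrite lt_def cabs_ge0 andbT cabs_eq0. Qed.

Lemma cabs_real t : cabs t%:C = `|t|.
Proof. by rewrite /cabs /= expr0n addr0 sqrtr_sqr. Qed.

Lemma cabs_sqr x : cabs x ^+ 2 = complex.Re x ^+ 2 + complex.Im x ^+ 2.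
Proof. by rewrite sqr_sqrtr // addr_ge0 ?sqr_ge0. Qed.

Lemma ler_Re_cabs x : `|complex.Re x| <= cabs x.
Proof. by rewrite -sqrtr_sqr ler_wsqrtr // lerDl sqr_ge0. Qed.

Lemma ler_Im_cabs x : `|complex.Im x| <= cabs x.
Proof. by rewrite -sqrtr_sqr ler_wsqrtr // lerDr sqr_ge0. Qed.

Lemma cabs_le_ReIm x : cabs x <= `|complex.Re x| + `|complex.Im x|.
Proof.
rewrite -(ler_pXn2r (n := 2)) ?nnegrE ?cabs_ge0 ?addr_ge0 //.
rewrite cabs_sqr -(real_normK (num_real (complex.Re x))).
rewrite -(real_normK (num_real (complex.Im x))).
rewrite sqrrD; have := mulr_ge0 (normr_ge0 (complex.Re x)) (normr_ge0 (complex.Im x)).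
by lra.
Qed.

(** Cauchy-Schwarz in the plane, by Lagrange's identity. With (p, q) the direction of a given value
    it replaces a modulus by a real linear functional. *)
Lemma cabs_ReIm_le x (p q : R) : p ^+ 2 + q ^+ 2 = 1 ->
  p * complex.Re x + q * complex.Im x <= cabs x.
Proof.
move=> pq; have := cabs_ge0 x => c0.
rewrite leNgt; apply/negP => h.
have : cabs x ^+ 2 < (p * complex.Re x + q * complex.Im x) ^+ 2.
  by rewrite ltr_pXn2r ?nnegrE // ltW // (le_lt_trans c0).
rewrite cabs_sqr => {h}; have := sqr_ge0 (p * complex.Im x - q * complex.Re x).
nra.
Qed.

Lemma cexpD x y : cexp (x + y) = cexp x * cexp y.
Proof.
apply: complex_eq; rewrite /cexp !ReImE /= expRD ?cosD ?sinD; ring.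
Qed.

Lemma cexp0 : cexp (0 : R[i]) = 1.
Proof. by apply: complex_eq; rewrite /cexp /= expR0 cos0 sin0; ring. Qed.

Lemma Re_cexp z : complex.Re (cexp z) = expR (complex.Re z) * cos (complex.Im z).
Proof. by rewrite /cexp !ReImE /=; ring. Qed.

Lemma Im_cexp z : complex.Im (cexp z) = expR (complex.Re z) * sin (complex.Im z).
Proof. by rewrite /cexp !ReImE /=; ring. Qed.

Lemma cabs_cexp z : cabs (cexp z) = expR (complex.Re z).
Proof.
rewrite /cabs Re_cexp Im_cexp !exprMn -mulrDr cos2Dsin2 mulr1 sqrtr_sqr.
by rewrite ger0_norm // expR_ge0.
Qed.

Lemma cexp_neq0 z : cexp z != 0.
Proof. by rewrite -cabs_gt0 cabs_cexp expR_gt0. Qed.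

Lemma cexp_real t : cexp t%:C = (expR t)%:C.
Proof. by apply: complex_eq; rewrite ?Re_cexp ?Im_cexp /= ?cos0 ?sin0; ring. Qed.

Lemma cexpN z : cexp (- z) = (cexp z)^-1.
Proof.
apply: (mulfI (cexp_neq0 z)); rewrite -cexpD subrr cexp0 divff //.
exact: cexp_neq0.
Qed.

Lemma cexpMn (n : nat) z : cexp (n%:R * z) = cexp z ^+ n.
Proof.
elim: n => [|n IH]; first by rewrite mul0r cexp0.
by rewrite -addn1 natrD mulrDl mul1r cexpD IH exprD expr1.
Qed.

Lemma cln_real_bounds x : x != 0 -> -1 <= complex.Re x / cabs x <= 1.
Proof.
rewrite -cabs_gt0 => x0; have := ler_Re_cabs x.
by rewrite -ler_norml normrM normfV (ger0_norm (cabs_ge0 x)) ler_pdivrMr // mul1r.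
Qed.

Lemma cexp_cln x : x != 0 -> cexp (cln x) = x.
Proof.
move=> x0; have := x0; rewrite -cabs_gt0 => c0.
have bd := cln_real_bounds x0.
have c00 := lt0r_neq0 c0.
(* This is the sine of [acos], hence the sine of the argument up to sign; the case distinction in
   [carg] supplies the sign of the imaginary part. *)
have s2 : Num.sqrt (1 - (complex.Re x / cabs x) ^+ 2) = `|complex.Im x| / cabs x.
  have -> : 1 - (complex.Re x / cabs x) ^+ 2 = (complex.Im x / cabs x) ^+ 2.
    rewrite !expr_div_n.
    have /eqP := cabs_sqr x; rewrite addrC -subr_eq => /eqP <-.
    by field.
  by rewrite sqrtr_sqr normrM normfV (ger0_norm (cabs_ge0 x)).
have elnc : expR (ln (cabs x)) = cabs x by apply: lnK; rewrite posrE.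
apply: complex_eq; rewrite ?Re_cexp ?Im_cexp /= elnc /carg.
  case: ifP => _; rewrite ?cosN acosK ?in_itv //=; by field.
case: ifP => h; rewrite ?sinN sin_acos // s2.
  by rewrite ger0_norm //; field.
by rewrite ltr0_norm ?ltNge ?h //; field.
Qed.

Lemma cln_real t : 0 < t -> cln t%:C = (ln t)%:C.
Proof.
move=> t0; rewrite /cln /carg cabs_real gtr0_norm //= lexx divff ?gt_eqF //.
by rewrite acos1.
Qed.

(** A positive factor leaves the argument unchanged, so the principal logarithm is additive here
    without a branch correction. *)
Lemma cln_scale t x : 0 < t -> x != 0 -> cln (t%:C * x) = (ln t)%:C + cln x.
Proof.
move=> t0 x0; have := x0; rewrite -cabs_gt0 => c0.
apply: complex_eq; rewrite !ReImE.
  transitivity (ln (cabs (t%:C * x))); first by [].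
  by rewrite cabsM cabs_real gtr0_norm // lnM ?posrE.
transitivity (carg (t%:C * x)); first by [].
rewrite add0r; transitivity (carg x); last by [].
rewrite /carg !ReImE !mul0r addr0 subr0 cabsM cabs_real gtr0_norm //.
rewrite pmulr_rge0 //.
have -> : t * complex.Re x / (t * cabs x) = complex.Re x / cabs x; last by [].
by field; rewrite !gt_eqF.
Qed.

End ComplexBasics.

(** * Taylor remainders of the complex exponential *)

Section ComplexTaylor.
Variable R : realType.
Implicit Types (z : R[i]) (t : R).

Definition cderiv (f g : R -> R[i]) := forall t,
  is_derive t 1 (fun u => complex.Re (f u)) (complex.Re (g t)) /\
  is_derive t 1 (fun u => complex.Im (f u)) (complex.Im (g t)).

Lemma cderivD (f f' g g' : R -> R[i]) : cderiv f f' -> cderiv g g' ->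
  cderiv (fun t => f t + g t) (fun t => f' t + g' t).
Proof.
move=> df dg t; have [h1 h2] := df t; have [h3 h4] := dg t.
split.
  under eq_fun do rewrite Re_add; rewrite Re_add; exact: is_deriveD.
under eq_fun do rewrite Im_add; rewrite Im_add; exact: is_deriveD.
Qed.

Lemma cderivZ (k : R[i]) (f f' : R -> R[i]) : cderiv f f' ->
  cderiv (fun t => k * f t) (fun t => k * f' t).
Proof.
move=> df t; have [h1 h2] := df t; split.
  under eq_fun do rewrite Re_mul; rewrite Re_mul.
  by apply: is_deriveB; apply: is_deriveZ.
under eq_fun do rewrite Im_mul; rewrite Im_mul.
by apply: is_deriveD; apply: is_deriveZ.
Qed.

Lemma is_derive_scaler (k t df : R) (f : R -> R) :
  is_derive t 1 f df -> is_derive t 1 (fun u => k * f u) (k * df).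
Proof. exact: is_deriveZ. Qed.

Lemma is_derive_expn (n : nat) (t : R) :
  is_derive t 1 (fun u : R => u ^+ n.+1) (n.+1%:R * t ^+ n).
Proof.
have -> : (fun u : R => u ^+ n.+1) = id ^+ n.+1.
  by apply/funext => u; rewrite fctE.
have := is_deriveX n.+1 (is_derive_id t (1 : R)).
by congr is_derive; rewrite /GRing.scale /= mulr1.
Qed.

Lemma cderiv_cst (k : R[i]) : cderiv (fun=> k) (fun=> 0).
Proof. by move=> t; split; exact: is_derive_cst. Qed.

Lemma cderiv_real (f g : R -> R) : (forall t, is_derive t 1 f (g t)) ->
  cderiv (fun t => (f t)%:C) (fun t => (g t)%:C).
Proof. by move=> h t; split => /=; [exact: h|exact: is_derive_cst]. Qed.

Lemma cderiv_cexpZ z : cderiv (fun t => cexp (t%:C * z)) (fun t => z * cexp (t%:C * z)).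
Proof.
move=> t; set a := complex.Re z; set b := complex.Im z.
have e (u : R) : expR (complex.Re (u%:C * z)) = expR (u * a).
  by rewrite !ReImE mul0r subr0.
have e2 (u : R) : complex.Im (u%:C * z) = u * b by rewrite !ReImE mul0r addr0.
have d1 (c : R) : is_derive t 1 (fun u : R => u * c) c.
  under eq_fun do rewrite mulrC.
  by rewrite -[X in is_derive _ _ _ X]mulr1; exact: is_derive_scaler.
have dE : is_derive t 1 (expR \o (fun u => u * a)) (a * expR (t * a)).
  have := is_derive1_comp (g := fun u : R => u * a) (is_derive_expR (t * a)) (d1 a).
  by congr is_derive; rewrite mulrC.
have dC : is_derive t 1 (cos \o (fun u => u * b)) (- b * sin (t * b)).
  have := is_derive1_comp (g := fun u : R => u * b) (is_derive_cos (t * b)) (d1 b).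
  by congr is_derive; rewrite /=; ring.
have dS : is_derive t 1 (sin \o (fun u => u * b)) (b * cos (t * b)).
  have := is_derive1_comp (g := fun u : R => u * b) (is_derive_sin (t * b)) (d1 b).
  by congr is_derive; rewrite /=; ring.
split.
  under eq_fun do rewrite Re_cexp e e2.
  have := is_deriveM dE dC.
  congr is_derive.
  transitivity (expR (t * a) * (- b * sin (t * b)) + cos (t * b) * (a * expR (t * a))).
    by [].
  by rewrite Re_mul Re_cexp Im_cexp e e2 -/a -/b; ring.
under eq_fun do rewrite Im_cexp e e2.
have := is_deriveM dE dS.
congr is_derive.
transitivity (expR (t * a) * (b * cos (t * b)) + sin (t * b) * (a * expR (t * a))).
  by [].
by rewrite Im_mul Re_cexp Im_cexp e e2 -/a -/b; ring.
Qed.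

(** A mean value inequality for complex values: project on the direction (p, q) of f(t0), so that
    the projection equals |f(t0)| at t0, subtract the claimed bound, and observe that the difference
    is nonincreasing from the value 0. The powers of t are chosen so that the lemma can be
    iterated. *)
Lemma cderiv_mean_value (f f' : R -> R[i]) (M : R) (n : nat) :
  cderiv f f' -> f 0 = 0 ->
  (forall t, 0 <= t <= 1 -> cabs (f' t) <= M * t ^+ n / n`!%:R) ->
  forall t, 0 <= t <= 1 -> cabs (f t) <= M * t ^+ n.+1 / n.+1`!%:R.
Proof.
move=> df f0 bd t0 /andP[t00 t01].
have [c0|c0] := eqVneq (cabs (f t0)) 0.
  rewrite c0; apply: divr_ge0 => //; apply: mulr_ge0; last exact: exprn_ge0.
  (* That M >= 0 is read off from the bound at t = 1. *)
  have := bd 1; rewrite ler01 lexx expr1n mulr1 => /(_ isT) h.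
  have := le_trans (cabs_ge0 _) h.
  by rewrite pmulr_lge0 // invr_gt0 ltr0n fact_gt0.
pose p := complex.Re (f t0) / cabs (f t0); pose q := complex.Im (f t0) / cabs (f t0).
have pq : p ^+ 2 + q ^+ 2 = 1.
  by rewrite /p /q !expr_div_n -mulrDl -cabs_sqr divff // expf_neq0.
pose g t := p * complex.Re (f t) + q * complex.Im (f t) - M * t ^+ n.+1 / n.+1`!%:R.
pose g' t := p * complex.Re (f' t) + q * complex.Im (f' t) - M * t ^+ n / n`!%:R.
have dg t : is_derive t 1 g (g' t).
  have [h1 h2] := df t.
  have d2 := is_derive_scaler (M / n.+1`!%:R) (is_derive_expn n t).
  have d1 := is_deriveD (is_derive_scaler p h1) (is_derive_scaler q h2).
  have e3 : M / n.+1`!%:R * (n.+1%:R * t ^+ n) = M * t ^+ n / n`!%:R.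
    rewrite factS natrM -natr1.
    by field; rewrite natr1 !pnatr_eq0 -lt0n fact_gt0.
  have := is_deriveB d1 d2; rewrite e3.
  by congr is_derive; apply/funext => u; rewrite /g !fctE; ring.
have cont : {within `[0, t0], continuous g}.
  apply: derivable_within_continuous => u _.
  by have := dg u; case.
have := @ler0_derive1_nincr R g 0 t0 _ _ cont 0 t0 (lexx _) t00 (lexx _).
have -> : g 0 = 0 by rewrite /g f0 /= !mulr0 expr0n /= mulr0 mul0r addr0 subr0.
have -> : g t0 = cabs (f t0) - M * t0 ^+ n.+1 / n.+1`!%:R.
  rewrite /g; congr (_ - _); rewrite /p /q.
  by apply: (mulfI c0); rewrite -expr2 cabs_sqr; field.
rewrite subr_le0; apply.
  by move=> u _; have := dg u; case.
move=> u; rewrite in_itv /= => /andP[u0 ut].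
rewrite derive1E; have := dg u => hu; rewrite derive_val /g' subr_le0.
apply: le_trans (cabs_ReIm_le (f' u) pq) _.
by apply: bd; rewrite ltW //= (le_trans (ltW ut)).
Qed.

(** Along the segment t z with 0 <= t <= 1, the derivative of the remainder of order n + 1 is z
    times the remainder of order n. Induction with [cderiv_mean_value] therefore gains a factor |z|
    t / (n + 1) at each order, starting from |exp(t z)| <= exp |z|. *)
Lemma cexp_taylor n z :
  cabs (cexp z - \sum_(k < n) z ^+ k / k`!%:R) <=
  expR (cabs z) * cabs z ^+ n / n`!%:R.
Proof.
pose S n t := \sum_(k < n) (t%:C * z) ^+ k / k`!%:R.
have dS m : cderiv (S m.+1) (fun t => z * S m t).
  elim: m => [|m IH].
    have -> : S 1 = fun=> 1 / 0`!%:R.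
      by apply/funext => t; rewrite /S big_ord1 expr0.
    have -> : (fun t => z * S 0 t) = fun=> 0.
      by apply/funext => t; rewrite /S big_ord0 mulr0.
    exact: cderiv_cst.
  have -> : S m.+2 = fun t => S m.+1 t + (t%:C * z) ^+ m.+1 / m.+1`!%:R.
    by apply/funext => t; rewrite /S big_ord_recr.
  have -> : (fun t => z * S m.+1 t) = fun t => z * S m t + z * ((t%:C * z) ^+ m / m`!%:R).
    by apply/funext => t; rewrite /S big_ord_recr /= mulrDr.
  apply: cderivD => //.
  have := cderivZ (z ^+ m.+1 / m.+1`!%:R) (cderiv_real (is_derive_expn m)).
  congr cderiv; apply/funext => t.
    by rewrite exprMn rmorphXn; ring.
  rewrite rmorphM rmorphXn rmorph_nat factS natrM exprMn /= exprS -natr1.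
  by field; rewrite natr1 !pnatr_eq0 -lt0n fact_gt0.
have H m : forall t, 0 <= t <= 1 -> cabs (cexp (t%:C * z) - S m t) <=
    (expR (cabs z) * cabs z ^+ m) * t ^+ m / m`!%:R.
  elim: m => [|m IH] t t01.
    rewrite /S big_ord0 subr0 cabs_cexp !expr0 fact0 divr1 !mulr1.
    rewrite ler_expR !ReImE mul0r subr0.
    case/andP: t01 => t0 t1.
    apply: le_trans (ler_Re_cabs z); apply: le_trans (ler_norm _) _.
    by rewrite normrM (ger0_norm t0) ler_piMl.
  apply: (@cderiv_mean_value (fun t => cexp (t%:C * z) - S m.+1 t)
    (fun t => z * (cexp (t%:C * z) - S m t))) => //.
  - have := cderivD (cderiv_cexpZ z) (cderivZ (-1) (dS m)).
    congr cderiv; apply/funext => u; first by rewrite mulN1r.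
    by ring.
  - rewrite /S mul0r cexp0 big_ord_recl expr0 fact0 divr1 big1 ?addr0 ?subrr //.
    by move=> i _; rewrite expr0n /= mul0r.
  move=> u u01; rewrite cabsM exprS.
  apply: le_trans (ler_wpM2l (cabs_ge0 z) (IH u u01)) _.
  by rewrite le_eqVlt; apply/orP; left; apply/eqP; ring.
have := H n 1; rewrite ler01 lexx => /(_ isT).
by rewrite expr1n mulr1 /S; under eq_bigr do rewrite mul1r; rewrite mul1r.
Qed.

End ComplexTaylor.

(** * Integrals of complex-valued functions *)

Section ComplexMeasurable.
Context d (T : measurableType d) (R : realType).
Implicit Types (D : set T) (f g : T -> R[i]).

Definition cmeas D f :=
  measurable_fun D (fun t => complex.Re (f t)) /\
  measurable_fun D (fun t => complex.Im (f t)).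

Lemma cmeasD D f g : cmeas D f -> cmeas D g -> cmeas D (fun t => f t + g t).
Proof.
move=> [f1 f2] [g1 g2]; split.
  by under eq_fun do rewrite Re_add; exact: measurable_funD.
by under eq_fun do rewrite Im_add; exact: measurable_funD.
Qed.

Lemma cmeasM D f g : cmeas D f -> cmeas D g -> cmeas D (fun t => f t * g t).
Proof.
move=> [f1 f2] [g1 g2]; split.
  under eq_fun do rewrite Re_mul.
  by apply: measurable_funB; exact: measurable_funM.
under eq_fun do rewrite Im_mul.
by apply: measurable_funD; exact: measurable_funM.
Qed.

Lemma cmeas_cst D (k : R[i]) : cmeas D (fun=> k).
Proof. by split; exact: measurable_cst. Qed.

Lemma cmeas_real D (f : T -> R) : measurable_fun D f -> cmeas D (fun t => (f t)%:C).
Proof. by move=> mf; split => //=; exact: measurable_cst. Qed.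

Lemma cmeas_line D (a b : T -> R) : measurable_fun D a -> measurable_fun D b ->
  cmeas D (fun t => a t +i* b t).
Proof. by move=> ma mb; split. Qed.

Lemma cmeas_cexp D f : cmeas D f -> cmeas D (fun t => cexp (f t)).
Proof.
move=> [f1 f2]; split.
  under eq_fun do rewrite Re_cexp.
  apply: measurable_funM; apply: measurableT_comp => //.
  by apply: continuous_measurable_fun; exact: continuous_cos.
under eq_fun do rewrite Im_cexp.
apply: measurable_funM; apply: measurableT_comp => //.
by apply: continuous_measurable_fun; exact: continuous_sin.
Qed.

End ComplexMeasurable.

Section ComplexContinuous.
Context (T : topologicalType) (R : realType).
Implicit Types (f g : T -> R[i]).

Definition ccont f :=
  continuous (fun t => complex.Re (f t) : R) /\
  continuous (fun t => complex.Im (f t) : R).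

Lemma ccontD f g : ccont f -> ccont g -> ccont (fun t => f t + g t).
Proof.
move=> [f1 f2] [g1 g2]; split=> x.
  by under eq_fun do rewrite Re_add; apply: cvgD; [exact: f1|exact: g1].
by under eq_fun do rewrite Im_add; apply: cvgD; [exact: f2|exact: g2].
Qed.

Lemma ccontM f g : ccont f -> ccont g -> ccont (fun t => f t * g t).
Proof.
move=> [f1 f2] [g1 g2]; split=> x.
  under eq_fun do rewrite Re_mul.
  by apply: cvgB; apply: cvgM; [exact: f1|exact: g1|exact: f2|exact: g2].
under eq_fun do rewrite Im_mul.
by apply: cvgD; apply: cvgM; [exact: f1|exact: g2|exact: f2|exact: g1].
Qed.

Lemma ccont_cst (k : R[i]) : ccont (fun=> k).
Proof. by split=> x; exact: cvg_cst. Qed.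

Lemma ccont_line (a b : T -> R) : continuous a -> continuous b ->
  ccont (fun t => a t +i* b t).
Proof. by move=> ma mb; split. Qed.

Lemma ccont_real (f : T -> R) : continuous f -> ccont (fun t => (f t)%:C).
Proof. by move=> mf; split => //= x; exact: cvg_cst. Qed.

Lemma ccontN f : ccont f -> ccont (fun t => - f t).
Proof.
move=> h; under eq_fun do rewrite -mulN1r.
by apply: ccontM => //; exact: ccont_cst.
Qed.

Lemma ccont_cexp f : ccont f -> ccont (fun t => cexp (f t)).
Proof.
move=> [f1 f2]; split=> x.
  under eq_fun do rewrite Re_cexp.
  apply: cvgM.
    exact: continuous_comp (f1 x) (@continuous_expR _ _).
  exact: continuous_comp (f2 x) (@continuous_cos _ _).
under eq_fun do rewrite Im_cexp.
apply: cvgM.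
  exact: continuous_comp (f1 x) (@continuous_expR _ _).
exact: continuous_comp (f2 x) (@continuous_sin _ _).
Qed.

Lemma ccontX f n : ccont f -> ccont (fun t => f t ^+ n).
Proof.
move=> mf; elim: n => [|n IH].
  by under eq_fun do rewrite expr0; exact: ccont_cst.
by under eq_fun do rewrite exprS; exact: ccontM.
Qed.

Lemma ccont_sum (f : nat -> T -> R[i]) n : (forall i, ccont (f i)) ->
  ccont (fun t => \sum_(i < n) f i t).
Proof.
move=> mf; elim: n => [|n IH].
  by under eq_fun do rewrite big_ord0; exact: ccont_cst.
by under eq_fun do rewrite big_ord_recr /=; exact: ccontD.
Qed.

End ComplexContinuous.

Lemma ccont_cmeas (R : realType) (f : R -> R[i]) (D : set (measurableTypeR R)) : measurable D ->
  ccont f -> @cmeas _ (measurableTypeR R) R D f.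
Proof.
by move=> mD [f1 f2]; split; apply: measurable_funTS; exact: continuous_measurable_fun.
Qed.

Lemma ccont_comp (R : realType) (T : topologicalType) (f : R -> R[i]) (g : T -> R) :
  ccont f -> continuous g -> ccont (fun t => f (g t)).
Proof.
move=> [f1 f2] cg; split=> x.
  exact: continuous_comp (cg x) (f1 _).
exact: continuous_comp (cg x) (f2 _).
Qed.

Lemma cmeas_comp (R : realType) d (T : measurableType d) (f : measurableTypeR R -> R[i]) (g : T -> R) :
  cmeas setT f -> measurable_fun setT g -> cmeas setT (fun t => f (g t)).
Proof. by move=> [f1 f2] mg; split; [exact: (measurableT_comp f1 mg)|exact: (measurableT_comp f2 mg)]. Qed.

Section ComplexIntegralTheory.
Variable R : realType.
Notation mu := (@lebesgue_measure R).
(* The structure on which [lebesgue_measure] lives; [R] itself carries a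
   convertible structure under another display, which defeats unification. *)
Notation RR := (measurableTypeR R).
Implicit Types (f g : RR -> R[i]) (D : set RR).

Lemma cintegrable_meas D f : cintegrable D f -> cmeas D f.
Proof.
move=> [f1 f2]; split; apply/measurable_EFinP.
  exact: measurable_int f1.
exact: measurable_int f2.
Qed.

Lemma cintegrable_le D f (g : RR -> R) : measurable D -> cmeas D f ->
  mu.-integrable D (EFin \o g) -> (forall x, D x -> cabs (f x) <= g x) ->
  cintegrable D f.
Proof.
move=> mD [f1 f2] ig fg; split; apply: (le_integrable mD _ _ ig).
- exact/measurable_EFinP.
- move=> x Dx; rewrite /= lee_fin (le_trans (ler_Re_cabs _)) //.
  by rewrite (le_trans (fg _ Dx)) // ler_norm.
- exact/measurable_EFinP.
- move=> x Dx; rewrite /= lee_fin (le_trans (ler_Im_cabs _)) //.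
  by rewrite (le_trans (fg _ Dx)) // ler_norm.
Qed.

Lemma integrable_comb D (a b : R) (u v : RR -> R) : measurable D ->
  mu.-integrable D (EFin \o u) -> mu.-integrable D (EFin \o v) ->
  mu.-integrable D (EFin \o (fun t => a * u t + b * v t)).
Proof.
move=> mD iu iv.
have := integrableD mD (integrableZl mD a iu) (integrableZl mD b iv).
by apply: eq_integrable => // x _; rewrite /= EFinD !EFinM.
Qed.

Lemma Rintegral_comb D (a b : R) (u v : RR -> R) : measurable D ->
  mu.-integrable D (EFin \o u) -> mu.-integrable D (EFin \o v) ->
  \int[mu]_(t in D) (a * u t + b * v t) =
  a * \int[mu]_(t in D) u t + b * \int[mu]_(t in D) v t.
Proof.
move=> mD iu iv; rewrite RintegralD //.
- by rewrite !RintegralZl.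
- have := integrableZl mD a iu; apply: eq_integrable => // x _.
- have := integrableZl mD b iv; apply: eq_integrable => // x _.
Qed.

Lemma cintegrable_eq D f g : measurable D -> (forall x, D x -> f x = g x) ->
  cintegrable D f -> cintegrable D g.
Proof.
move=> mD fg [f1 f2]; split.
  by apply: eq_integrable f1 => // x /set_mem Dx; rewrite /= fg.
by apply: eq_integrable f2 => // x /set_mem Dx; rewrite /= fg.
Qed.

Lemma eq_cintegral D f g : (forall x, D x -> f x = g x) ->
  cintegral D f = cintegral D g.
Proof.
move=> fg; rewrite /cintegral; congr (_ +i* _); apply: eq_Rintegral => x /set_mem Dx;
  by rewrite fg.
Qed.

Lemma cintegrableD D f g : measurable D -> cintegrable D f -> cintegrable D g ->
  cintegrable D (fun t => f t + g t).
Proof.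
move=> mD [f1 f2] [g1 g2]; split.
  have := integrable_comb 1 1 mD f1 g1.
  by apply: eq_integrable => // x _; rewrite /= Re_add !mul1r.
have := integrable_comb 1 1 mD f2 g2.
by apply: eq_integrable => // x _; rewrite /= Im_add !mul1r.
Qed.

Lemma cintegralD D f g : measurable D -> cintegrable D f -> cintegrable D g ->
  cintegral D (fun t => f t + g t) = cintegral D f + cintegral D g.
Proof.
move=> mD [f1 f2] [g1 g2]; apply: complex_eq; rewrite ?Re_add ?Im_add /=.
  by rewrite -RintegralD //; apply: eq_Rintegral => x _; rewrite Re_add.
by rewrite -RintegralD //; apply: eq_Rintegral => x _; rewrite Im_add.
Qed.

Lemma cintegrableZ D f (k : R[i]) : measurable D -> cintegrable D f ->
  cintegrable D (fun t => k * f t).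
Proof.
move=> mD [f1 f2]; split.
  have := integrable_comb (complex.Re k) (- complex.Im k) mD f1 f2.
  by apply: eq_integrable => // x _; rewrite /= Re_mul mulNr.
have := integrable_comb (complex.Re k) (complex.Im k) mD f2 f1.
by apply: eq_integrable => // x _; rewrite /= Im_mul.
Qed.

Lemma cintegralZ D f (k : R[i]) : measurable D -> cintegrable D f ->
  cintegral D (fun t => k * f t) = k * cintegral D f.
Proof.
move=> mD [f1 f2]; apply: complex_eq; rewrite ?Re_mul ?Im_mul /=.
  rewrite -mulNr -Rintegral_comb //; apply: eq_Rintegral => x _.
  by rewrite Re_mul mulNr.
by rewrite -Rintegral_comb //; apply: eq_Rintegral => x _; rewrite Im_mul.
Qed.

Lemma cintegralB D f g : measurable D -> cintegrable D f -> cintegrable D g ->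
  cintegral D (fun t => f t - g t) = cintegral D f - cintegral D g.
Proof.
move=> mD f1 g1; rewrite -[- cintegral D g]mulN1r -cintegralZ // -cintegralD //.
  by apply: eq_cintegral => x _; rewrite mulN1r.
exact: cintegrableZ.
Qed.

Lemma cintegrableB D f g : measurable D -> cintegrable D f -> cintegrable D g ->
  cintegrable D (fun t => f t - g t).
Proof.
move=> mD f1 g1; have := cintegrableD mD f1 (cintegrableZ (-1) mD g1).
by apply: cintegrable_eq => // x _; rewrite mulN1r.
Qed.

Lemma cintegrable_eqT f g : (forall x, f x = g x) ->
  cintegrable setT f -> cintegrable setT g.
Proof. by move=> /funext ->. Qed.

Lemma eq_cintegralT f g : (forall x, f x = g x) ->
  cintegral setT f = cintegral setT g.
Proof. by move=> /funext ->. Qed.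

(** The factor 2 comes from bounding real and imaginary part separately. The sharp constant would
    bring nothing, since the bound only enters estimates with unspecified constants. *)
Lemma cabs_cintegral_le D f (g : RR -> R) : measurable D -> cmeas D f ->
  mu.-integrable D (EFin \o g) -> (forall x, D x -> cabs (f x) <= g x) ->
  cabs (cintegral D f) <= 2 * \int[mu]_(t in D) g t.
Proof.
move=> mD mf ig fg; have [f1 f2] := cintegrable_le mD mf ig fg.
rewrite (le_trans (cabs_le_ReIm _)) // mulr_natl mulr2n /=.
apply: lerD; (apply: le_trans (le_normr_Rintegral _ _) _ => //;
  apply: le_Rintegral => //; first exact: integrable_norm).
  by move=> x Dx; rewrite (le_trans (ler_Re_cabs _)) // fg.
by move=> x Dx; rewrite (le_trans (ler_Im_cabs _)) // fg.
Qed.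

Lemma cvg_cabs_ReIm (u : nat -> R[i]) (l : R[i]) :
  (cabs (u n - l) @[n --> \oo] --> (0 : R)) <->
  (complex.Re (u n) @[n --> \oo] --> complex.Re l) /\
  (complex.Im (u n) @[n --> \oo] --> complex.Im l).
Proof.
split=> [h|[h1 h2]].
  split; apply: cvg_sub0; [| exact: cvg_cst | | exact: cvg_cst].
    apply: norm_cvg0; apply: (squeeze_cvgr _ (cvg_cst 0) h).
    apply: nearW => n; rewrite normr_ge0 /=; have := ler_Re_cabs (u n - l).
    by rewrite Re_add Re_opp.
  apply: norm_cvg0; apply: (squeeze_cvgr _ (cvg_cst 0) h).
  apply: nearW => n; rewrite normr_ge0 /=; have := ler_Im_cabs (u n - l).
  by rewrite Im_add Im_opp.
have h3 : `|complex.Re (u n) - complex.Re l| + `|complex.Im (u n) - complex.Im l|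
    @[n --> \oo] --> (0 : R).
  rewrite -[0 in X in _ --> X]addr0; apply: cvgD.
    rewrite -[0 in X in _ --> X](normr0 R) -(subrr (complex.Re l)).
    by apply: cvg_norm; apply: cvgB => //; exact: cvg_cst.
  rewrite -[0 in X in _ --> X](normr0 R) -(subrr (complex.Im l)).
  by apply: cvg_norm; apply: cvgB => //; exact: cvg_cst.
apply: (squeeze_cvgr _ (cvg_cst 0) h3).
apply: nearW => n; rewrite cabs_ge0 /= (le_trans (cabs_le_ReIm _)) //.
by rewrite !ReImE.
Qed.

Lemma cvg_cabs_unique (u : nat -> R[i]) (l l' : R[i]) :
  cabs (u n - l) @[n --> \oo] --> (0 : R) ->
  cabs (u n - l') @[n --> \oo] --> (0 : R) -> l = l'.
Proof.
move=> /cvg_cabs_ReIm[h1 h2] /cvg_cabs_ReIm[h3 h4].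
by apply: complex_eq; [apply: cvg_unique h1 h3|apply: cvg_unique h2 h4].
Qed.

Lemma Rintegral_dominated D (f_ : nat -> RR -> R) (f g : RR -> R) : measurable D ->
  (forall n, measurable_fun D (f_ n)) -> measurable_fun D f ->
  mu.-integrable D (EFin \o g) ->
  (forall n x, D x -> `|f_ n x| <= g x) ->
  (forall x, D x -> f_ n x @[n --> \oo] --> f x) ->
  \int[mu]_(t in D) (f_ n t) @[n --> \oo] --> \int[mu]_(t in D) f t.
Proof.
move=> mD mf_ mf ig fg cf.
have [] := @dominated_convergence _ _ _ mu D mD (fun n => EFin \o f_ n) (EFin \o f) (EFin \o g).
- by move=> n; exact/measurable_EFinP.
- exact/measurable_EFinP.
- by apply: aeW => x Dx; apply: cvg_EFin; [exact: nearW|exact: cf].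
- exact: ig.
- by apply: aeW => x n Dx; rewrite /= lee_fin fg.
move=> i _ h; rewrite /Rintegral; apply: fine_cvg.
by rewrite fineK //; exact: integrable_fin_num.
Qed.

Lemma cintegral_dominated D (f_ : nat -> RR -> R[i]) f (g : RR -> R) : measurable D ->
  (forall n, cmeas D (f_ n)) -> cmeas D f ->
  mu.-integrable D (EFin \o g) ->
  (forall n x, D x -> cabs (f_ n x) <= g x) ->
  (forall x, D x -> cabs (f_ n x - f x) @[n --> \oo] --> (0 : R)) ->
  cabs (cintegral D (f_ n) - cintegral D f) @[n --> \oo] --> (0 : R).
Proof.
move=> mD mf_ mf ig fg cf; apply/cvg_cabs_ReIm => /=; split.
  apply: (Rintegral_dominated mD _ _ ig) => //.
  - by move=> n; have [] := mf_ n.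
  - by case: mf.
  - by move=> n x Dx; rewrite (le_trans (ler_Re_cabs _)) // fg.
  - by move=> x /cf /cvg_cabs_ReIm[].
apply: (Rintegral_dominated mD _ _ ig) => //.
- by move=> n; have [] := mf_ n.
- by case: mf.
- by move=> n x Dx; rewrite (le_trans (ler_Im_cabs _)) // fg.
- by move=> x /cf /cvg_cabs_ReIm[].
Qed.

Lemma integrable_prod (g h : RR -> R) :
  mu.-integrable setT (EFin \o g) -> mu.-integrable setT (EFin \o h) ->
  (mu \x mu)%E.-integrable setT (EFin \o (fun z : RR * RR => g z.1 * h z.2)).
Proof.
move=> ig ih.
have mg : measurable_fun setT g by apply/measurable_EFinP; exact: measurable_int ig.
have mh : measurable_fun setT h by apply/measurable_EFinP; exact: measurable_int ih.
apply/integrable12ltyP.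
  apply/measurable_EFinP; apply: measurable_funM; exact: measurableT_comp.
under eq_integral => x _.
  under eq_integral => y _ do rewrite /= normrM EFinM.
  rewrite ge0_integralZl //; last first.
    by apply/measurable_EFinP; exact: measurableT_comp.
  over.
have /integrableP[_ hb] := ih; have /integrableP[_ gb] := ig.
rewrite ge0_integralZr //; last 2 first.
- by apply/measurable_EFinP; exact: measurableT_comp.
- exact: integral_ge0.
by apply: lte_mul_pinfty => //; [exact: integral_ge0|rewrite ge0_fin_numE // integral_ge0].
Qed.

(** A majorant in product form makes every section integrable, not merely almost every one. Each
    inner [Rintegral] is then a genuine finite integral, and its [fine] can be undone pointwise
    before [Fubini] is applied. *)
Lemma Rintegral_fubini (f : RR * RR -> R) (g h : RR -> R) :
  measurable_fun setT f ->
  mu.-integrable setT (EFin \o g) -> mu.-integrable setT (EFin \o h) ->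
  (forall x y, `|f (x, y)| <= g x * h y) ->
  mu.-integrable setT (EFin \o (fun x => \int[mu]_y f (x, y))) /\
  \int[mu]_x (\int[mu]_y f (x, y)) = \int[mu]_y (\int[mu]_x f (x, y)).
Proof.
move=> mf ig ih fgh.
have mg : measurable_fun setT g by apply/measurable_EFinP; exact: measurable_int ig.
have mh : measurable_fun setT h by apply/measurable_EFinP; exact: measurable_int ih.
have i2 : (mu \x mu)%E.-integrable setT (EFin \o f).
  apply: (le_integrable _ _ _ (integrable_prod ig ih)) => //.
    exact/measurable_EFinP.
  by move=> [x y] _; rewrite /= lee_fin (le_trans (fgh x y)) // ler_norm.
have e1 x : (\int[mu]_y f (x, y))%:E = (\int[mu]_y (f (x, y))%:E)%E.
  rewrite /Rintegral fineK //; apply: integrable_fin_num => //.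
  apply: (le_integrable _ _ _ (integrableZl measurableT (g x) ih)) => //.
    by apply/measurable_EFinP; exact: measurableT_comp.
  by move=> y _; rewrite /= lee_fin (le_trans (fgh x y)) // ler_norm.
have e2 y : (\int[mu]_x f (x, y))%:E = (\int[mu]_x (f (x, y))%:E)%E.
  rewrite /Rintegral fineK //; apply: integrable_fin_num => //.
  apply: (le_integrable _ _ _ (integrableZr measurableT (h y) ig)) => //.
    by apply/measurable_EFinP; exact: measurableT_comp.
  by move=> x _; rewrite /= lee_fin (le_trans (fgh x y)) // ler_norm.
split.
  by have := integrable_fubini_F i2; apply: eq_integrable => // x _; rewrite /= e1.
rewrite /Rintegral; congr fine.
transitivity (\int[mu]_x \int[mu]_y (f (x, y))%:E)%E.
  by apply: eq_integral => x _; rewrite -e1.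
by rewrite (Fubini i2); apply: eq_integral => y _; rewrite -e2.
Qed.

Lemma cintegral_fubini (f : RR * RR -> R[i]) (g h : RR -> R) :
  cmeas setT f ->
  mu.-integrable setT (EFin \o g) -> mu.-integrable setT (EFin \o h) ->
  (forall x y, cabs (f (x, y)) <= g x * h y) ->
  cintegrable setT (fun x => cintegral setT (fun y => f (x, y))) /\
  cintegral setT (fun x => cintegral setT (fun y => f (x, y))) =
  cintegral setT (fun y => cintegral setT (fun x => f (x, y))).
Proof.
move=> [m1 m2] ig ih fgh.
have [i1 e1] := Rintegral_fubini m1 ig ih (fun x y => le_trans (ler_Re_cabs _) (fgh x y)).
have [i2 e2] := Rintegral_fubini m2 ig ih (fun x y => le_trans (ler_Im_cabs _) (fgh x y)).
by split; [split|apply: complex_eq].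
Qed.

End ComplexIntegralTheory.

(** * Changes of variables and integrable bounds *)

Section Substitution.
Variable R : realType.
Notation mu := (@lebesgue_measure R).
Notation RR := (measurableTypeR R).

Lemma integrable_ge0_fin (D : set RR) (f : RR -> R) : measurable_fun D f ->
  mu.-integrable D (EFin \o f) <-> (\int[mu]_(x in D) (`|f x|)%:E < +oo)%E.
Proof.
move=> mf; split=> [/integrableP[]//|h].
by apply/integrableP; split => //; exact/measurable_EFinP.
Qed.

(** Lifts a change of variables from nonnegative continuous functions to signed ones through f =
    (|f| + f) - |f|, whose two terms are again continuous and nonnegative. *)
Lemma Rintegral_subst (D1 D2 : set RR) (phi rho f : RR -> R) :
  measurable D1 -> measurable D2 ->
  (forall G : R -> R, continuous G -> (forall x, 0 <= G x) ->
     (\int[mu]_(x in D1) (G x)%:E = \int[mu]_(x in D2) (G (phi x) * rho x)%:E)%E) ->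
  (forall x, D2 x -> 0 <= rho x) ->
  continuous (f : R -> R) -> mu.-integrable D1 (EFin \o f) ->
  measurable_fun D2 (fun x => f (phi x) * rho x) ->
  mu.-integrable D2 (EFin \o (fun x => f (phi x) * rho x)) /\
  \int[mu]_(x in D1) f x = \int[mu]_(x in D2) (f (phi x) * rho x).
Proof.
move=> mD1 mD2 sub rho0 cf f1 mf2.
have cn : continuous (fun x : R => `|f x| : R).
  by move=> x; apply: cvg_norm; exact: cf.
have f2 : mu.-integrable D2 (EFin \o (fun x => f (phi x) * rho x)).
  apply/integrable_ge0_fin => //.
  have /integrableP[_] := f1; congr (_ < _)%E.
  rewrite [LHS](sub (fun x => `|f x|)) //; apply: eq_integral => x /set_mem Dx.
  by rewrite normrM (ger0_norm (rho0 _ Dx)).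
split => //.
pose G x := `|f x| + f x.
have cG : continuous (G : R -> R) by move=> x; apply: cvgD; [exact: cn|exact: cf].
have G0 x : 0 <= G x by rewrite -lerBlDr sub0r -normrN ler_norm.
have tr (H : R -> R) : continuous H -> (forall x, 0 <= H x) ->
    \int[mu]_(x in D1) H x = \int[mu]_(x in D2) (H (phi x) * rho x).
  by move=> cH H0; rewrite /Rintegral (sub H).
have i1 := integrable_norm f1; have i2 := integrable_norm f2.
transitivity (1 * \int[mu]_(x in D1) G x + (-1) * \int[mu]_(x in D1) `|f x|).
  rewrite -Rintegral_comb //.
    by apply: eq_Rintegral => x _; rewrite /G; ring.
  by have := integrable_comb 1 1 mD1 i1 f1; apply: eq_integrable => // x _;
    rewrite /= /G !mul1r.
rewrite (tr G) // (tr (fun x => `|f x|)) // -Rintegral_comb //.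
- by apply: eq_Rintegral => x _; rewrite /G; ring.
- have := integrable_comb 1 1 mD2 i2 f2; apply: eq_integrable => // x /set_mem Dx.
  by rewrite /= /G !mul1r normrM (ger0_norm (rho0 _ Dx)) mulrDl.
- apply: eq_integrable i2 => // x /set_mem Dx.
  by rewrite /= normrM (ger0_norm (rho0 _ Dx)).
Qed.

Lemma cintegral_subst (D1 D2 : set RR) (phi rho : RR -> R) (f : RR -> R[i]) :
  measurable D1 -> measurable D2 ->
  (forall G : R -> R, continuous G -> (forall x, 0 <= G x) ->
     (\int[mu]_(x in D1) (G x)%:E = \int[mu]_(x in D2) (G (phi x) * rho x)%:E)%E) ->
  (forall x, D2 x -> 0 <= rho x) ->
  @ccont R R f -> cintegrable D1 f ->
  cmeas D2 (fun x => f (phi x) * (rho x)%:C) ->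
  cintegrable D2 (fun x => f (phi x) * (rho x)%:C) /\
  cintegral D1 f = cintegral D2 (fun x => f (phi x) * (rho x)%:C).
Proof.
move=> mD1 mD2 sub rho0 [c1 c2] [i1 i2] [m1 m2].
have e1 x : complex.Re (f (phi x) * (rho x)%:C) = complex.Re (f (phi x)) * rho x.
  by rewrite Re_mul /= mulr0 subr0.
have e2 x : complex.Im (f (phi x) * (rho x)%:C) = complex.Im (f (phi x)) * rho x.
  by rewrite Im_mul /= mulr0 add0r.
have {}m1 : measurable_fun D2 (fun x => complex.Re (f (phi x)) * rho x).
  by under eq_fun do rewrite -e1.
have {}m2 : measurable_fun D2 (fun x => complex.Im (f (phi x)) * rho x).
  by under eq_fun do rewrite -e2.
have [j1 k1] := Rintegral_subst mD1 mD2 sub rho0 c1 i1 m1.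
have [j2 k2] := Rintegral_subst mD1 mD2 sub rho0 c2 i2 m2.
split.
  split.
    by apply: eq_integrable j1 => // x _; rewrite /= e1.
  by apply: eq_integrable j2 => // x _; rewrite /= e2.
apply: complex_eq; rewrite /= ?k1 ?k2; apply: eq_Rintegral => x _.
  by rewrite e1.
by rewrite e2.
Qed.

Lemma integral_affine (k b : R) (G : R -> R) : 0 < k ->
  continuous G -> (forall x, 0 <= G x) ->
  (\int[mu]_x (G x)%:E = \int[mu]_x (G (k * x + b) * k)%:E)%E.
Proof.
move=> k0 cG G0; pose F x := k * x + b.
have dF (x : R) : is_derive x 1 F k.
  have := is_deriveD (is_derive_scaler k (is_derive_id (x : R) (1 : R))) (is_derive_cst b (x : R) (1 : R)).
  by rewrite addr0 mulr1.
have F'E : F^`()%classic = fun=> k.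
  by apply/funext => x; rewrite derive1E derive_val.
rewrite (@increasing_ge0_integration_by_substitutionT R F G) //.
- by apply: eq_integral => x _; rewrite F'E.
- by move=> x y xy; rewrite /F ltrD2r ltr_pM2l.
- by rewrite F'E => x; exact: cvg_cst.
- by rewrite F'E; exact: is_cvg_cst.
- by rewrite F'E; exact: is_cvg_cst.
- apply/cvgrNyPle => A.
  have /filterS := @nbhs_ninfty_le R _ (num_real (k^-1 * (A - b))); apply => x.
  by rewrite ler_pdivlMl // lerBrDr.
- apply/cvgryPge => A.
  have /filterS := @nbhs_pinfty_ge R _ (num_real (k^-1 * (A - b))); apply => x.
  by rewrite ler_pdivrMl // lerBlDr.
Qed.

Lemma cintegral_affine (k b : R) (f : RR -> R[i]) : 0 < k ->
  @ccont R R f -> cintegrable setT f ->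
  cintegrable setT (fun x => f (k * x + b)) /\
  cintegral setT f = k%:C * cintegral setT (fun x => f (k * x + b)).
Proof.
move=> k0 cf fi.
have cfk : @ccont R R (fun x => f (k * x + b)).
  apply: (@ccont_comp R R f) => // x.
  by apply: cvgD; [apply: cvgM; [exact: cvg_cst|exact: cvg_id]|exact: cvg_cst].
have [] := @cintegral_subst setT setT (fun x => k * x + b) (fun=> k) f
  measurableT measurableT _ _ cf fi _.
- by move=> G cG G0; exact: integral_affine.
- by move=> x _; exact: ltW.
- by apply: ccont_cmeas => //; apply: ccontM => //; exact: ccont_cst.
move=> i1 ->.
have i2 : cintegrable setT (fun x : RR => f (k * x + b)).
  have := cintegrableZ k^-1%:C measurableT i1.
  apply: cintegrable_eq => // x _; rewrite mulrCA -rmorphM mulVf ?gt_eqF //.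
  by rewrite mulr1.
split => //; rewrite -cintegralZ //.
by apply: eq_cintegral => x _; rewrite mulrC.
Qed.

Lemma cintegral_shift (b : R) (f : RR -> R[i]) :
  @ccont R R f -> cintegrable setT f ->
  cintegrable setT (fun x => f (x + b)) /\
  cintegral setT f = cintegral setT (fun x => f (x + b)).
Proof.
move=> cf fi; have [] := cintegral_affine b ltr01 cf fi.
rewrite mul1r; have -> : (fun x => f (1 * x + b)) = (fun x => f (x + b)); last by [].
by apply/funext => x; rewrite mul1r.
Qed.

(** The substitution is made on the compact intervals [-n, n], whose images under exp are
    [exp(-n), exp n]; monotone convergence on both sides then exhausts the line and the open
    half-line. *)
Lemma integral_exp (G : R -> R) : continuous G -> (forall x, 0 <= G x) ->
  (\int[mu]_x (G x)%:E = \int[mu]_(x in `]0%R, +oo[) (G (ln x) * x^-1)%:E)%E.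
Proof.
move=> cG G0.
have mG : measurable_fun [set: RR] G by exact: continuous_measurable_fun.
pose H (x : RR) := G (ln x) * x^-1.
have cH x : 0 < x -> {for x, continuous (H : R -> R)}.
  move=> x0; apply: cvgM.
    by apply: continuous_comp; [exact: continuous_ln|exact: cG].
  by apply: cvgV => //; rewrite gt_eqF.
have mH : measurable_fun (`]0, +oo[%classic : set RR) H.
  apply: open_continuous_measurable_fun; first exact: interval_open.
  by move=> x; rewrite inE /= in_itv /= andbT => x0; exact: cH.
have step (n : nat) : (\int[mu]_(x in `[(- n%:R)%R, n%:R]) (G x)%:E =
    \int[mu]_(x in `[expR (- n%:R), expR n%:R]) (H x)%:E)%E.
  have nn : - n%:R <= n%:R :> R by rewrite ge0_cp // ler0n.
  rewrite (@integration_by_substitution_increasing R expR H) //.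
  - apply: eq_integral => x _; congr EFin.
    rewrite fctE derive1E derive_val /H /= expRK -mulrA mulVf ?mulr1 //.
    by rewrite gt_eqF // expR_gt0.
  - by move=> x y _ _ xy; rewrite ltr_expR.
  - move=> x _; rewrite (_ : expR^`()%classic = expR) //.
      exact: continuous_expR.
    by apply/funext => y; rewrite derive1E derive_val.
  - rewrite (_ : expR^`()%classic = expR); last first.
      by apply/funext => y; rewrite derive1E derive_val.
    by apply/cvg_ex; exists (expR (- n%:R)); apply: cvg_at_right_filter; exact: continuous_expR.
  - rewrite (_ : expR^`()%classic = expR); last first.
      by apply/funext => y; rewrite derive1E derive_val.
    by apply/cvg_ex; exists (expR n%:R); apply: cvg_at_left_filter; exact: continuous_expR.
  - split.
    + by move=> x _; exact: derivable_expR.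
    + by apply: cvg_at_right_filter; exact: continuous_expR.
    + by apply: cvg_at_left_filter; exact: continuous_expR.
  - apply: continuous_in_subspaceT => x; rewrite inE /= in_itv /= => /andP[x0 _].
    by apply: cH; rewrite (lt_le_trans _ x0) // expR_gt0.
have U1 : \bigcup_n `[(- n%:R)%R, n%:R]%classic = [set: R].
  apply/seteqP; split => // x _.
  exists (Num.truncn `|x|).+1 => //=; rewrite in_itv /= -ler_norml.
  by rewrite ltW // truncnS_gt.
have U2 : \bigcup_n `[expR (- n%:R), expR n%:R]%classic = (`]0, +oo[ : set R)%classic.
  apply/seteqP; split => x.
    move=> [n _] /=; rewrite !in_itv /= andbT => /andP[h _].
    by rewrite (lt_le_trans _ h) // expR_gt0.
  rewrite /= in_itv /= andbT => x0.
  exists (Num.truncn `|ln x|).+1 => //=; rewrite in_itv /=.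
  have := ltW (truncnS_gt `|ln x|); rewrite ler_norml => /andP[h1 h2].
  by rewrite -{2 3}[x]lnK ?posrE // !ler_expR h1.
rewrite -U2 -[X in (integral _ X _)]U1.
have c1 : (\int[mu]_(x in `[(- n%:R)%R, n%:R]) (G x)%:E)%E @[n --> \oo] -->
    (\int[mu]_(x in \bigcup_n `[(- n%:R)%R, n%:R]%classic) (G x)%:E)%E.
  apply: (@ge0_nondecreasing_set_cvg_integral _ RR R
    (fun n => `[(- n%:R)%R, n%:R]%classic) (EFin \o G) mu).
  - move=> n m nm; apply/subsetPset => x /=; rewrite !in_itv /= => /andP[h1 h2].
    by rewrite (le_trans _ h1) ?lerN2 ?ler_nat //= (le_trans h2) // ler_nat.
  - by move=> n; exact: measurable_itv.
  - by move=> n; apply/measurable_EFinP; exact: measurable_funTS.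
  - by move=> n x _; rewrite lee_fin.
have c2 : (\int[mu]_(x in `[expR (- n%:R), expR n%:R]) (H x)%:E)%E @[n --> \oo] -->
    (\int[mu]_(x in \bigcup_n `[expR (- n%:R), expR n%:R]%classic) (H x)%:E)%E.
  apply: (@ge0_nondecreasing_set_cvg_integral _ RR R
    (fun n => `[expR (- n%:R), expR n%:R]%classic) (EFin \o H) mu).
  - move=> n m nm; apply/subsetPset => x /=; rewrite !in_itv /= => /andP[h1 h2].
    by rewrite (le_trans _ h1) ?ler_expR ?lerN2 ?ler_nat //= (le_trans h2) // ler_expR ler_nat.
  - by move=> n; exact: measurable_itv.
  - move=> n; apply/measurable_EFinP; apply: measurable_funS mH => //.
    move=> x /=; rewrite !in_itv /= andbT => /andP[h _].
    by rewrite (lt_le_trans _ h) // expR_gt0.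
  - move=> n x /=; rewrite in_itv /= => /andP[h _].
    by rewrite lee_fin mulr_ge0 // invr_ge0 (le_trans _ h) // expR_ge0.
move: c1; under eq_fun do rewrite step; move=> c1.
exact: (cvg_unique (@ereal_hausdorff R) c1 c2).
Qed.

Lemma cintegral_exp (f : RR -> R[i]) :
  @ccont R R f -> cintegrable setT f ->
  cintegrable `]0, +oo[ (fun x => f (ln x) * (x^-1)%:C) /\
  cintegral setT f = cintegral `]0, +oo[ (fun x => f (ln x) * (x^-1)%:C).
Proof.
move=> cf fi.
have m2 : cmeas (`]0, +oo[%classic : set RR) (fun x => f (ln x) * (x^-1)%:C).
  apply: cmeasM.
    have [h1 h2] : cmeas setT (fun x : RR => f (ln x)).
      apply: cmeas_comp; last exact: measurable_ln.
      exact: ccont_cmeas.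
    by split; apply: measurable_funTS.
  apply: cmeas_real.
  apply: open_continuous_measurable_fun; first exact: interval_open.
  move=> x; rewrite inE /= in_itv /= andbT => x0.
  by apply: cvgV; rewrite ?gt_eqF //; exact: cvg_id.
apply: (cintegral_subst (phi := @ln R) (rho := fun x => x^-1)) => //.
- by move=> G cG G0; exact: integral_exp.
- by move=> x /=; rewrite in_itv /= andbT => x0; rewrite invr_ge0 ltW.
Qed.

Lemma cintegral_reflect (f : RR -> R[i]) :
  @ccont R R f -> cintegrable `[0, +oo[ f ->
  cintegrable `]-oo, 0] (fun x => f (- x)) /\
  cintegral `[0, +oo[ f = cintegral `]-oo, 0] (fun x => f (- x)).
Proof.
move=> cf fi.
have mf : cmeas (`]-oo, 0] : set RR) (fun x => f (- x)).
  apply: ccont_cmeas => //; apply: (@ccont_comp R R f) => // x.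
  by apply: cvgN; exact: cvg_id.
have [] := @cintegral_subst `[0, +oo[%classic `]-oo, 0]%classic (fun x => - x) (fun=> 1) f
    _ _ _ _ cf fi _ => //.
- move=> G cG G0; under [RHS]eq_integral do rewrite mulr1.
  apply: (@ge0_integration_by_substitution0 R (EFin \o G)) => //.
  by apply/measurable_EFinP; exact: continuous_measurable_fun.
- have -> : (fun x : RR => f (- x) * 1%:C) = (fun x => f (- x)); last by [].
  by apply/funext => x; rewrite mulr1.
have -> : (fun x : RR => f (- x) * 1%:C) = (fun x => f (- x)); last by [].
by apply/funext => x; rewrite mulr1.
Qed.

End Substitution.

(** * The Lorentzian as common majorant *)

Section Lorentz.
Variable R : realType.
Notation mu := (@lebesgue_measure R).
Notation RR := (measurableTypeR R).

(** The Lorentzian 1 / (1 + v^2), an unnormalised Cauchy density. Being at most 1, it also dominates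
    products of two functions that it dominates up to constants; and 2 [lor] is the Fourier
    transform of exp(-|t|). *)
Definition lor (v : R) : R := (oneDsqr v)^-1.

Lemma lor_ge0 v : 0 <= lor v. Proof. by rewrite invr_ge0 (le_trans ler01) // oneDsqr_ge1. Qed.

Lemma lor_le1 v : lor v <= 1. Proof. exact: oneDsqrV_le1. Qed.

Lemma integral_lor : (\int[mu]_v (lor v)%:E = (pi : R)%:E)%E.
Proof.
rewrite ge0_symfun_integralT.
- have -> : [set x : R | 0 <= x] = `[0, +oo[%classic.
    by apply/seteqP; split => x /=; rewrite in_itv /= andbT.
  by rewrite integral0y_oneDsqr -EFinM; congr EFin; field.
- exact: lor_ge0.
- exact: continuous_oneDsqrV.
- by move=> x; rewrite /= /lor /oneDsqr sqrrN.
Qed.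

Lemma integrable_lor : mu.-integrable setT (EFin \o lor).
Proof.
apply/integrable_ge0_fin.
  by apply: continuous_measurable_fun; exact: continuous_oneDsqrV.
under eq_integral do rewrite ger0_norm ?lor_ge0 //.
by rewrite integral_lor ltry.
Qed.

Lemma Rintegral_lor : \int[mu]_v lor v = pi.
Proof. by rewrite /Rintegral integral_lor. Qed.

Lemma integrable_lorZ (C : R) : mu.-integrable setT (EFin \o (fun v => C * lor v)).
Proof.
have := integrable_comb C 0 measurableT integrable_lor integrable_lor.
by apply: eq_integrable => // x _; rewrite /= mul0r addr0.
Qed.

Lemma cintegrable_lor (f : RR -> R[i]) (C : R) : cmeas setT f ->
  (forall v, cabs (f v) <= C * lor v) -> cintegrable setT f.
Proof.
by move=> mf fC; apply: (cintegrable_le measurableT mf (integrable_lorZ C)) => x _.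
Qed.

Lemma cabs_cintegral_lor (f : RR -> R[i]) (C : R) : cmeas setT f ->
  (forall v, cabs (f v) <= C * lor v) -> cabs (cintegral setT f) <= C * (2 * pi).
Proof.
move=> mf fC.
apply: le_trans (cabs_cintegral_le measurableT mf (integrable_lorZ C) _) _.
  by move=> x _.
by rewrite RintegralZl //; [rewrite Rintegral_lor; lra|exact: integrable_lor].
Qed.

Lemma expRN_lor (k : R) : 0 < k ->
  exists2 C : R, 0 <= C & forall v, expR (- (k * `|v|)) <= C * lor v.
Proof.
move=> k0; have k20 : 0 < k ^+ 2 by rewrite exprn_gt0.
(* Chosen so that exp y >= 1 + y^2 / 2 at y = k |v| suffices: (1 + k^2 v^2 / 2)(1 + 2 / k^2) exceeds
   1 + v^2. *)
exists (1 + 2 / k ^+ 2) => [|v].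
  by rewrite addr_ge0 // divr_ge0 // ltW.
have v1 : 0 < oneDsqr v by rewrite (lt_le_trans ltr01) // oneDsqr_ge1.
rewrite /lor ler_pdivlMr // expRN ler_pdivrMl ?expR_gt0 //.
have := @expR_ge1Dxn R (k * `|v|) 1; rewrite mulr_ge0 ?(ltW k0) // => /(_ isT).
rewrite exprMn real_normK ?num_real // => h.
have C0 : 0 <= 1 + 2 / k ^+ 2 by rewrite addr_ge0 // divr_ge0 // ltW.
have := ler_wpM2r C0 h; apply: le_trans.
have -> : (1 + k ^+ 2 * v ^+ 2 / 2`!%:R) * (1 + 2 / k ^+ 2) =
    oneDsqr v + (k ^+ 2 * v ^+ 2 / 2 + 2 / k ^+ 2).
  by rewrite /oneDsqr !factS fact0 !muln1; field; rewrite gt_eqF.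
by rewrite lerDl; apply: addr_ge0; apply: divr_ge0 => //; [rewrite mulr_ge0 ?sqr_ge0|exact: ltW].
Qed.

(** Turns doubly exponential decay on the right into exponential decay on both sides. For v < 0 the
    term al v decays by itself; for v >= 0, exp v >= 1 + v^2 / 2 and 2 al^2 / de is the maximum of 2
    al v - de v^2 / 2. *)
Lemma sub_expR_bound (al de v : R) : 0 < al -> 0 < de ->
  al * v - de * expR v <= 2 * al ^+ 2 / de - al * `|v|.
Proof.
move=> al0 de0.
have c0 : 0 <= 2 * al ^+ 2 / de.
  by rewrite divr_ge0 ?mulr_ge0 ?sqr_ge0 // ltW.
have [v0|v0] := leP 0 v; last first.
  by rewrite ltr0_norm //; have := mulr_gt0 de0 (expR_gt0 v); lra.
rewrite ger0_norm //.
have := @expR_ge1Dxn R v 1 v0; rewrite !factS fact0 !muln1 => h.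
have {h} := ler_wpM2l (ltW de0) h.
have -> : de * (1 + v ^+ 2 / 2) =
  de + 2 * al * v - 2 * al ^+ 2 / de + de / 2 * (v - 2 * al / de) ^+ 2.
  by field; rewrite gt_eqF.
have : 0 <= de / 2 * (v - 2 * al / de) ^+ 2.
  by rewrite mulr_ge0 ?sqr_ge0 ?divr_ge0 // ltW.
by lra.
Qed.

Lemma expR_sub_expR_lor (al de : R) : 0 < al -> 0 < de ->
  exists2 C : R, 0 <= C & forall v, expR (al * v - de * expR v) <= C * lor v.
Proof.
move=> al0 de0; have [C C0 HC] := expRN_lor al0.
exists (expR (2 * al ^+ 2 / de) * C) => [|v]; first by rewrite mulr_ge0 ?expR_ge0.
rewrite -mulrA; apply: le_trans (ler_wpM2l (expR_ge0 _) (HC v)).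
by rewrite -expRD ler_expR sub_expR_bound.
Qed.

Lemma sqr_le_expR (k : R) : 0 < k ->
  exists2 C : R, 0 <= C & forall y, 0 <= y -> (1 + y) ^+ 2 <= C * expR (k * y).
Proof.
move=> k0; have k20 : 0 < k ^+ 2 by rewrite exprn_gt0.
have C0 : 0 <= 2 * (1 + 2 / k ^+ 2).
  by rewrite mulr_ge0 // addr_ge0 // divr_ge0 // ltW.
exists (2 * (1 + 2 / k ^+ 2)) => // y y0.
have := @expR_ge1Dxn R (k * y) 1; rewrite mulr_ge0 ?(ltW k0) // => /(_ isT) h.
apply: le_trans (ler_wpM2l C0 h).
have -> : 2 * (1 + 2 / k ^+ 2) * (1 + (k * y) ^+ 2 / 2`!%:R) =
    (1 + y) ^+ 2 + ((1 - y) ^+ 2 + k ^+ 2 * y ^+ 2 + 4 / k ^+ 2).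
  by rewrite !factS fact0 !muln1; field; rewrite gt_eqF.
rewrite lerDl addr_ge0 //; last by rewrite divr_ge0 // ltW.
by rewrite addr_ge0 ?sqr_ge0 // mulr_ge0 ?sqr_ge0.
Qed.

End Lorentz.

(** * Euler's integral along horizontal lines *)

Section GammaLine.
Variable R : realType.
Notation mu := (@lebesgue_measure R).
Notation RR := (measurableTypeR R).
Implicit Types (a z : R[i]) (th : R).

Lemma cexp_taylor1 z : cabs (cexp z - 1) <= expR (cabs z) * cabs z.
Proof.
by have := cexp_taylor 1 z; rewrite big_ord1 expr0 fact0 !divr1 !expr1.
Qed.

Lemma cexp_taylor2 z : cabs (cexp z - 1 - z) <= expR (cabs z) * cabs z ^+ 2.
Proof.
have := cexp_taylor 2 z; rewrite 2!big_ord_recr big_ord0 /= expr0 expr1 !factS fact0 !muln1.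
rewrite !divr1 add0r opprD addrA => h; apply: le_trans h _.
rewrite ler_pdivrMr // ler_peMr ?ler1n //.
by rewrite mulr_ge0 ?expR_ge0 ?exprn_ge0 ?cabs_ge0.
Qed.

(** Euler's integrand t^(a-1) exp(-t) dt under t = exp z. It is entire in z, so no branch of a power
    appears, and the ray of angle th becomes the horizontal line Im z = th. *)
Definition gline a z : R[i] := cexp (a * z - cexp z).

Lemma cabs_gline a (v th : R) : cabs (gline a (v +i* th)) =
  expR (complex.Re a * v - complex.Im a * th - expR v * cos th).
Proof. by rewrite cabs_cexp Re_add Re_opp Re_mul Re_cexp. Qed.

Lemma ccont_hline th : @ccont R R (fun v => v +i* th).
Proof. by apply: ccont_line => x; [exact: cvg_id|exact: cvg_cst]. Qed.

Lemma ccont_gline a th : @ccont R R (fun v => gline a (v +i* th)).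
Proof.
apply: ccont_cexp; apply: ccontD.
  by apply: ccontM; [exact: ccont_cst|exact: ccont_hline].
by apply: ccontN; apply: ccont_cexp; exact: ccont_hline.
Qed.

Lemma cmeas_gline a th : @cmeas _ RR R setT (fun v => gline a (v +i* th)).
Proof. by apply: ccont_cmeas => //; exact: ccont_gline. Qed.

Lemma gline_le a (de T th v : R) : `|th| <= T -> de <= cos th ->
  cabs (gline a (v +i* th)) <=
  expR (`|complex.Im a| * T) * expR (complex.Re a * v - de * expR v).
Proof.
move=> thT dc; rewrite cabs_gline -expRD ler_expR.
have h1 : - (complex.Im a * th) <= `|complex.Im a| * T.
  rewrite (le_trans (ler_norm _)) // normrN normrM ler_wpM2l //.
have h2 := ler_wpM2r (expR_ge0 v) dc.
by rewrite [expR v * cos th]mulrC; lra.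
Qed.

Lemma gline_lor a (de T : R) : 0 < complex.Re a -> 0 < de ->
  exists2 C : R, 0 <= C & forall th, `|th| <= T -> de <= cos th ->
    forall v, cabs (gline a (v +i* th)) <= C * lor v.
Proof.
move=> a0 de0; have [C C0 HC] := expR_sub_expR_lor a0 de0.
exists (expR (`|complex.Im a| * T) * C); first by rewrite mulr_ge0 ?expR_ge0.
move=> th thT dc v; apply: le_trans (gline_le _ _ thT dc) _.
by rewrite -mulrA ler_wpM2l ?expR_ge0.
Qed.

Lemma cintegrable_gline a th : 0 < complex.Re a -> 0 < cos th ->
  cintegrable setT (fun v : RR => gline a (v +i* th)).
Proof.
move=> a0 c0; have [C C0 HC] := gline_lor `|th| a0 c0.
apply: (cintegrable_lor (C := C)); first exact: cmeas_gline.
by move=> v; exact: HC.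
Qed.

(* With this second-order estimate, translation invariance of the integral does
   all the work: a real eta gives that the integral of the derivative vanishes,
   an imaginary eta that the integral is constant along the strip. *)
Lemma gline_increment a (de T : R) : 0 < complex.Re a -> 0 < de ->
  exists2 C : R, 0 <= C & exists2 h0 : R, 0 < h0 &
    forall th, `|th| <= T -> de <= cos th -> forall eta, cabs eta <= h0 ->
    forall v, cabs (gline a (v +i* th + eta) - gline a (v +i* th)
      - eta * (a - cexp (v +i* th)) * gline a (v +i* th)) <=
      cabs eta ^+ 2 * C * lor v.
Proof.
move=> a0 de0.
pose E : R := expR 1; pose K := cabs a + E.
have E0 : 0 < E by exact: expR_gt0.
have K0 : 0 < K by rewrite ltr_wpDl // cabs_ge0.
(* A quarter, because two factors exp(ka y) are lost, one to exp |D| and one to (1 + y)^2, and half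
   of the decay exp(-de y) is to survive. *)
pose ka := de / 4.
have ka0 : 0 < ka by rewrite divr_gt0.
have [C1 C10 HC1] := sqr_le_expR ka0.
have de20 : 0 < de / 2 by rewrite divr_gt0.
have [C2 C20 HC2] := expR_sub_expR_lor a0 de20.
have KE0 : 0 <= K ^+ 2 + E by rewrite addr_ge0 ?sqr_ge0 // ltW.
exists ((K ^+ 2 + E) * C1 * expR ka * expR (`|complex.Im a| * T) * C2).
  by rewrite !mulr_ge0 ?expR_ge0.
(* The bound 1 keeps exp |eta| below [E]; the bound ka / K gives |D| <= ka (1 + y) below. *)
exists (Num.min 1 (ka / K)); first by rewrite lt_min ltr01 divr_gt0.
move=> th thT dc eta; rewrite le_min => /andP[m1 mK] v.
set ze := v +i* th; set m := cabs eta; set y := expR v.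
have m0 : 0 <= m by exact: cabs_ge0.
have y0 : 0 < y by exact: expR_gt0.
have cy : cabs (cexp ze) = y by rewrite cabs_cexp.
have Em : expR m <= E by rewrite ler_expR.
have t1 : cabs (cexp eta - 1) <= E * m.
  by apply: le_trans (cexp_taylor1 _) _; rewrite ler_wpM2r.
have t2 : cabs (cexp eta - 1 - eta) <= E * m ^+ 2.
  by apply: le_trans (cexp_taylor2 _) _; rewrite ler_wpM2r ?sqr_ge0.
(* [D] is the exponent of the quotient of [gline a (ze + eta)] by [gline a ze]. It differs from the
   first-order term eta (a - exp ze) by exp(ze) (exp eta - 1 - eta), so the error splits into two
   second-order remainders, one in [D] and one in [eta]. *)
pose D : R[i] := a * eta - cexp ze * (cexp eta - 1).
have dD : cabs D <= m * K * (1 + y).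
  apply: le_trans (ler_cabsB _ _) _; rewrite (cabsM a) (cabsM (cexp ze)) cy -/m.
  have h := ler_wpM2l (ltW y0) t1.
  have ca : 0 <= cabs a by exact: cabs_ge0.
  have : m * K * (1 + y) = cabs a * m + y * (E * m) + (m * (cabs a * y) + m * E).
    by rewrite /K; ring.
  have : 0 <= m * (cabs a * y) + m * E by rewrite addr_ge0 ?mulr_ge0 // ltW.
  lra.
have mKka : m * K <= ka by rewrite -ler_pdivlMr.
have dD2 : cabs D <= ka * (1 + y).
  by apply: le_trans dD _; rewrite ler_wpM2r // addr_ge0 // ltW.
have -> : gline a (ze + eta) - gline a ze - eta * (a - cexp ze) * gline a ze =
   gline a ze * ((cexp D - 1 - D) - cexp ze * (cexp eta - 1 - eta)).
  have -> : gline a (ze + eta) = gline a ze * cexp D.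
    by rewrite /gline -cexpD cexpD; congr cexp; rewrite /D; ring.
  by rewrite /D; ring.
have br : cabs ((cexp D - 1 - D) - cexp ze * (cexp eta - 1 - eta)) <=
    m ^+ 2 * (K ^+ 2 + E) * (1 + y) ^+ 2 * expR (ka * (1 + y)).
  apply: le_trans (ler_cabsB _ _) _; rewrite cabsM cy.
  have s1 : cabs (cexp D - 1 - D) <= expR (ka * (1 + y)) * (m * K * (1 + y)) ^+ 2.
    apply: le_trans (cexp_taylor2 _) _; apply: ler_pM; rewrite ?expR_ge0 ?sqr_ge0 //.
      by rewrite ler_expR.
    by rewrite ler_pXn2r ?nnegrE ?cabs_ge0 // (le_trans (cabs_ge0 D)).
  have s2 : y * cabs (cexp eta - 1 - eta) <= expR (ka * (1 + y)) * (E * m ^+ 2 * (1 + y) ^+ 2).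
    apply: (@le_trans _ _ (y * (E * m ^+ 2))); first by rewrite ler_wpM2l // ltW.
    apply: (@le_trans _ _ (E * m ^+ 2 * (1 + y) ^+ 2)).
      rewrite mulrC ler_wpM2l ?mulr_ge0 ?sqr_ge0 ?(ltW E0) //.
      by have := sqr_ge0 y; rewrite sqrrD expr1n mul1r; lra.
    apply: ler_peMl; first by rewrite mulr_ge0 ?sqr_ge0 // mulr_ge0 ?sqr_ge0 // ltW.
    by rewrite -[leLHS]expR0 ler_expR mulr_ge0 ?(ltW ka0) // addr_ge0 // ltW.
  have := lerD s1 s2.
  have -> : expR (ka * (1 + y)) * (m * K * (1 + y)) ^+ 2 +
    expR (ka * (1 + y)) * (E * m ^+ 2 * (1 + y) ^+ 2) =
    m ^+ 2 * (K ^+ 2 + E) * (1 + y) ^+ 2 * expR (ka * (1 + y)) by ring.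
  by [].
rewrite cabsM.
have gl := gline_le a v thT dc.
apply: le_trans (ler_pM (cabs_ge0 _) (cabs_ge0 _) gl br) _.
have e1 : expR (ka * (1 + y)) = expR ka * expR (ka * y) by rewrite -expRD mulrDr mulr1.
have e2 : expR (complex.Re a * v - de * expR v) * (expR (ka * y) * expR (ka * y)) =
    expR (complex.Re a * v - de / 2 * expR v).
  by rewrite -!expRD; congr expR; rewrite /ka -/y; field.
have hp := HC1 y (ltW y0).
set P := expR (`|complex.Im a| * T); set Q := expR (complex.Re a * v - de * expR v).
have P0 : 0 <= P by exact: expR_ge0.
have Q0 : 0 <= Q by exact: expR_ge0.
apply: (@le_trans _ _ (P * Q * (m ^+ 2 * (K ^+ 2 + E) * (C1 * expR (ka * y)) * expR (ka * (1 + y))))).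
  rewrite ler_wpM2l ?mulr_ge0 // ler_wpM2r ?expR_ge0 // ler_wpM2l //.
  by rewrite mulr_ge0 ?sqr_ge0.
rewrite e1.
have -> : P * Q * (m ^+ 2 * (K ^+ 2 + E) * (C1 * expR (ka * y)) * (expR ka * expR (ka * y))) =
  m ^+ 2 * ((K ^+ 2 + E) * C1 * expR ka * P) * (Q * (expR (ka * y) * expR (ka * y))) by ring.
rewrite e2 mulrA -!mulrA ler_wpM2l ?sqr_ge0 // !mulrA.
rewrite -[X in _ <= X]mulrA.
by apply: ler_wpM2l => //; rewrite !mulr_ge0 ?expR_ge0.
Qed.

Lemma ler_small_eq0 (x C h0 : R) : 0 <= x -> 0 < h0 ->
  (forall h, 0 < h <= h0 -> x <= h * C) -> x = 0.
Proof.
move=> x0 h00 H; apply/eqP; rewrite eq_le x0 andbT leNgt; apply/negP => xp.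
pose h := Num.min h0 (x / (2 * (`|C| + 1))).
have C1 : 0 < `|C| + 1 by rewrite ltr_wpDl.
have hp : 0 < h by rewrite lt_min h00 divr_gt0 // mulr_gt0.
have := H h; rewrite hp ge_min lexx /= => /(_ isT) xh.
have h2 : h * C <= x / 2.
  apply: (@le_trans _ _ (h * (`|C| + 1))).
    by rewrite ler_wpM2l ?(ltW hp) // (le_trans (ler_norm C)) // lerDl.
  rewrite -ler_pdivlMr // (@le_trans _ _ (x / (2 * (`|C| + 1)))) ?ge_min ?lexx ?orbT //.
  by rewrite invfM mulrA.
lra.
Qed.

Lemma line_shift (v th h : R) : v +i* th + h%:C = (v + h) +i* th.
Proof. by apply: complex_eq; rewrite ReImE //= addr0. Qed.

Lemma line_add (v : R) (xi : R[i]) :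
  (v + complex.Re xi) +i* complex.Im xi = v%:C + xi.
Proof. by apply: complex_eq; rewrite ?Re_add ?Im_add; [|exact: esym (add0r _)]. Qed.

Lemma line_rotate (v th h : R) : v +i* th + h *i = v +i* (th + h).
Proof. by apply: complex_eq; rewrite ReImE //= addr0. Qed.

(** The left side is the derivative of [gline a]. Written through the integrands for a and a + 1 it
    is visibly integrable, and the vanishing of its integral is the functional equation of Gamma. *)
Lemma gline_deriv_split a z : (a - cexp z) * gline a z = a * gline a z - gline (a + 1) z.
Proof.
rewrite mulrBl; congr (_ - _); rewrite /gline -cexpD; congr cexp; ring.
Qed.

Lemma cintegrable_gline_deriv a th : 0 < complex.Re a -> 0 < cos th ->
  cintegrable setT (fun v : RR => (a - cexp (v +i* th)) * gline a (v +i* th)).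
Proof.
move=> a0 c0.
have a10 : 0 < complex.Re (a + 1) by rewrite Re_add addr_gt0.
have i1 := cintegrableZ a measurableT (cintegrable_gline a0 c0).
have i2 := cintegrableZ (-1) measurableT (cintegrable_gline a10 c0).
apply: cintegrable_eqT (cintegrableD measurableT i1 i2) => v.
by rewrite gline_deriv_split mulN1r.
Qed.

Lemma cmeas_gline_incr a th (eta : R[i]) : @cmeas _ RR R setT
  (fun v => gline a (v +i* th + eta) - gline a (v +i* th)
      - eta * (a - cexp (v +i* th)) * gline a (v +i* th)).
Proof.
apply: ccont_cmeas => //.
have c1 := @ccont_hline th; have c2 : @ccont R R (fun v => v +i* th + eta).
  by apply: ccontD => //; exact: ccont_cst.
apply: ccontD.
  apply: ccontD.
    apply: ccont_cexp; apply: ccontD; last by apply: ccontN; exact: ccont_cexp.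
    by apply: ccontM => //; exact: ccont_cst.
  by apply: ccontN; exact: ccont_gline.
apply: ccontN; apply: ccontM; last exact: ccont_gline.
apply: ccontM; first exact: ccont_cst.
apply: ccontD; first exact: ccont_cst.
by apply: ccontN; exact: ccont_cexp.
Qed.

(** For a real increment h the two translates of [gline] have equal integrals and cancel.
    Integrating the second-order estimate leaves h |J| = O(h^2) for the integral J in question,
    hence J = 0. *)
Lemma cintegral_gline_deriv a th : 0 < complex.Re a -> 0 < cos th ->
  cintegral setT (fun v : RR => (a - cexp (v +i* th)) * gline a (v +i* th)) = 0.
Proof.
move=> a0 c0; apply/eqP; rewrite -cabs_eq0; apply/eqP.
have [C C0 [h0 h00 H]] := gline_increment `|th| a0 c0.
apply: (@ler_small_eq0 _ (C * (2 * pi)) h0); [exact: cabs_ge0|exact: h00|].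
move=> h /andP[hp hh].
have ch : cabs h%:C = h by rewrite cabs_real gtr0_norm.
have cm := cmeas_gline_incr a th h%:C.
have := H th (lexx _) (lexx _) h%:C; rewrite ch => /(_ hh) /(cabs_cintegral_lor cm).
set J := cintegral setT _.
have i1 := cintegrable_gline a0 c0.
have [i2 e2] := cintegral_shift h (ccont_gline a th) i1.
have i3 := cintegrable_gline_deriv a0 c0.
have -> : J = - (h%:C * cintegral setT (fun v : RR => (a - cexp (v +i* th)) * gline a (v +i* th))).
  rewrite /J -(cintegralZ _ measurableT i3).
  have i4 := cintegrableZ h%:C measurableT i3.
  have i5 : cintegrable setT (fun v : RR => gline a ((v + h) +i* th) - gline a (v +i* th)).
    exact: cintegrableB.
  transitivity (cintegral setT (fun v : RR => gline a ((v + h) +i* th) - gline a (v +i* th)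
    - h%:C * ((a - cexp (v +i* th)) * gline a (v +i* th)))).
    by apply: eq_cintegralT => v; rewrite line_shift mulrA.
  by rewrite (cintegralB measurableT i5 i4) (cintegralB measurableT i2 i1) -e2 subrr sub0r.
by rewrite cabsN cabsM ch expr2 -!mulrA ler_pM2l.
Qed.

Lemma ler_cos_abs (t th : R) : `|t| <= `|th| -> `|th| < pi / 2 -> cos th <= cos t.
Proof.
move=> tth thp.
have ca (x : R) : cos x = cos `|x| by have [//|//] := ger0P x; rewrite cosN.
rewrite (ca t) (ca th).
have pi2 : pi / 2 <= pi :> R by have := pi_gt0 R; lra.
have b1 : `|th| <= pi by rewrite (le_trans (ltW thp)).
have [->//|ne] := eqVneq `|t| `|th|.
by rewrite ltW // ltr_cos ?in_itv /= ?normr_ge0 ?b1 ?(le_trans tth) // lt_neqAle ne.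
Qed.

(** A step of height h changes the integral by O(h^2), because the first-order term integrates to 0.
    Dividing the way from 0 to th into n equal steps gives a total change O(1/n), hence none. *)
Lemma cintegral_gline_rotate a th : 0 < complex.Re a -> `|th| < pi / 2 ->
  cintegral setT (fun v : RR => gline a (v +i* th)) =
  cintegral setT (fun v : RR => gline a (v%:C)).
Proof.
move=> a0 thp; pose I t := cintegral setT (fun v : RR => gline a (v +i* t)).
rewrite -[RHS]/(I 0) -[LHS]/(I th).
have c0 : 0 < cos th by apply: cos_gt0_pihalf; rewrite -ltr_norml.
have [C C0 [h0 h00 H]] := gline_increment `|th| a0 c0.
have step t h : `|t| <= `|th| -> `|t + h| <= `|th| -> `|h| <= h0 ->
    cabs (I (t + h) - I t) <= h ^+ 2 * (C * (2 * pi)).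
  move=> tt tht hh.
  have ct := ler_cos_abs tt thp; have ct0 := lt_le_trans c0 ct.
  have cth := ler_cos_abs tht thp; have cth0 := lt_le_trans c0 cth.
  have ch : cabs (h *i) = `|h| by rewrite /cabs /= expr0n add0r sqrtr_sqr.
  have cm := cmeas_gline_incr a t (h *i).
  have := @cabs_cintegral_lor R _ (`|h| ^+ 2 * C) cm; rewrite -{1}ch.
  move=> /(_ (fun v => H t tt ct (h *i) _ v)); rewrite ch => /(_ hh).
  rewrite real_normK ?num_real // -mulrA; congr (cabs _ <= _).
  have i1 := cintegrable_gline a0 ct0; have i2 := cintegrable_gline a0 cth0.
  have i3 := cintegrableZ (h *i) measurableT (cintegrable_gline_deriv a0 ct0).
  have i5 : cintegrable setT (fun v : RR => gline a (v +i* (t + h)) - gline a (v +i* t)).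
    exact: cintegrableB.
  transitivity (cintegral setT (fun v : RR => gline a (v +i* (t + h)) - gline a (v +i* t)
    - (h *i) * ((a - cexp (v +i* t)) * gline a (v +i* t)))).
    by apply: eq_cintegralT => v; rewrite line_rotate mulrA.
  rewrite (cintegralB measurableT i5 i3) (cintegralB measurableT i2 i1).
  rewrite cintegralZ //; last exact: cintegrable_gline_deriv.
  by rewrite cintegral_gline_deriv // mulr0 subr0.
apply/eqP; rewrite -subr_eq0 -cabs_eq0; apply/eqP.
(* With more than [N] steps each step has length at most [h0], the range of the second-order
   estimate. *)
pose N := Num.truncn (`|th| / h0).
have main (n : nat) : (N < n)%N -> cabs (I th - I 0) <= th ^+ 2 * (C * (2 * pi)) / n%:R.
  move=> Nn; have n0 : 0 < n%:R :> R by rewrite ltr0n (leq_ltn_trans _ Nn).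
  pose h := th / n%:R.
  have hh : `|h| <= h0.
    rewrite normrM normfV (gtr0_norm n0) ler_pdivrMr // mulrC -ler_pdivrMr //.
    by rewrite ltW // (lt_le_trans (truncnS_gt _)) // ler_nat.
  have kh (k : nat) : (k <= n)%N -> `|k%:R * h| <= `|th|.
    move=> kn; rewrite normrM normrM normfV (gtr0_norm n0) ger0_norm //.
    by rewrite mulrCA ler_piMr // ler_pdivrMr // mul1r ler_nat.
  have ind (k : nat) : (k <= n)%N -> cabs (I (k%:R * h) - I 0) <= k%:R * (h ^+ 2 * (C * (2 * pi))).
    elim: k => [_|k IH kn]; first by rewrite !mul0r subrr cabs0.
    have -> : I (k.+1%:R * h) - I 0 = (I (k%:R * h + h) - I (k%:R * h)) + (I (k%:R * h) - I 0).
      by rewrite -natr1 mulrDl mul1r addrA subrK.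
    apply: le_trans (ler_cabsD _ _) _.
    rewrite -natr1 mulrDl mul1r addrC lerD ?IH ?(ltnW kn) //.
    apply: step => //; first by rewrite kh // ltnW.
    by rewrite -[X in _ + X]mul1r -mulrDl natr1 kh.
  have := ind n (leqnn n).
  have -> : n%:R * h = th by rewrite /h mulrC divfK // gt_eqF.
  by congr (_ <= _); rewrite /h; field; rewrite gt_eqF.
apply: (@ler_small_eq0 _ (2 * (th ^+ 2 * (C * (2 * pi)))) (N.+1%:R)^-1); first exact: cabs_ge0.
  by rewrite invr_gt0 ltr0n.
move=> h /andP[hp hN].
(* Translates O(1/n) into O(h): since n <= 1/h < n + 1 <= 2 n, one has 1/n <= 2 h, whence the factor
   2 above. The restriction h <= 1/(N + 1) ensures n > N. *)
pose n := (Num.truncn h^-1).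
have n1 : (N < n)%N.
  have hN1 : N.+1%:R <= h^-1 by rewrite -[N.+1%:R]invrK lef_pV2 ?posrE ?invr_gt0 ?ltr0n.
  by rewrite /n truncn_ge_nat // ltW // invr_gt0.
have n0 : 0 < n%:R :> R by rewrite ltr0n (leq_ltn_trans _ n1).
apply: le_trans (main n n1) _.
set X := th ^+ 2 * _; rewrite [X / _]mulrC [h * _]mulrA ler_wpM2r //.
  by rewrite (mulr_ge0 (sqr_ge0 _)) // (mulr_ge0 C0) // (mulr_ge0 _ (pi_ge0 _)).
rewrite invf_ple ?posrE ?mulr_gt0 //.
rewrite invfM ler_pdivrMr //.
have := ltW (truncnS_gt h^-1); rewrite -/n -natr1 => hh.
have : 1 <= n%:R :> R by rewrite ler1n (leq_ltn_trans _ n1).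
lra.
Qed.

Lemma cGammaE a : 0 < complex.Re a ->
  cGamma a = cintegral setT (fun v : RR => gline a v%:C).
Proof.
move=> a0; have i1 := @cintegrable_gline a 0 a0; rewrite cos0 in i1.
have [_ ->] := cintegral_exp (ccont_gline a 0) (i1 ltr01).
apply: eq_cintegral => t /=; rewrite in_itv /= andbT => t0.
rewrite /cpow cln_real // /gline -[ln t +i* 0]/((ln t)%:C) cexpD cexp_real lnK ?posrE //.
rewrite mulrBl mul1r cexpD [cexp (- (ln t)%:C)]cexpN cexp_real lnK ?posrE // fmorphV; ring.
Qed.

Lemma cGammaS a : 0 < complex.Re a -> cGamma (a + 1) = a * cGamma a.
Proof.
move=> a0.
have a10 : 0 < complex.Re (a + 1) by rewrite Re_add addr_gt0.
have c0 : 0 < cos (0 : R) by rewrite cos0.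
have := cintegral_gline_deriv a0 c0.
have i1 := cintegrable_gline a0 c0; have i2 := cintegrable_gline a10 c0.
have i3 := cintegrableZ a measurableT i1.
rewrite (eq_cintegral (g := fun v : RR => a * gline a (v +i* 0) - gline (a + 1) (v +i* 0))).
  rewrite cintegralB // cintegralZ // -!cGammaE // => /eqP.
  by rewrite subr_eq0 => /eqP.
by move=> v _; exact: gline_deriv_split.
Qed.

Lemma cGamma_pochhammer a n : 0 < complex.Re a ->
  cGamma (a + n%:R) = pochhammer a n * cGamma a.
Proof.
move=> a0; elim: n => [|n IH].
  by rewrite addr0 /pochhammer big_geq // mul1r.
rewrite -natr1 addrA cGammaS; last by rewrite Re_add natC /= ltr_wpDr.
by rewrite IH /pochhammer big_nat_recr //= mulrA [_ * (a + _)]mulrC.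
Qed.

(** With lam = exp xi and t = exp v this is the formula Gamma(a) = lam^a times the integral of
    t^(a-1) exp(-lam t). The real part of xi is removed by translation, the imaginary part by
    rotation. *)
Lemma cintegral_gline_shift a (xi : R[i]) : 0 < complex.Re a -> `|complex.Im xi| < pi / 2 ->
  cintegrable setT (fun v : RR => gline a (v%:C + xi)) /\
  cintegral setT (fun v : RR => gline a (v%:C + xi)) = cGamma a.
Proof.
move=> a0 xp.
have c0 : 0 < cos (complex.Im xi) by apply: cos_gt0_pihalf; rewrite -ltr_norml.
have i1 := cintegrable_gline a0 c0.
have [i2 e2] := cintegral_shift (complex.Re xi) (ccont_gline a (complex.Im xi)) i1.
have e v : (v + complex.Re xi) +i* complex.Im xi = v%:C + xi.
  exact: line_add.
split; first by apply: cintegrable_eqT i2 => v; congr gline; exact: e.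
rewrite (cGammaE a0) -(cintegral_gline_rotate a0 xp) e2.
by apply: eq_cintegralT => v; congr gline; exact: esym (e v).
Qed.

End GammaLine.

(** * The Mellin transform of a Gaussian times a sine *)

Section SineSeries.
Variable R : realType.
Implicit Types (z w x : R[i]).

Definition csin_partial (N : nat) z : R[i] :=
  \sum_(n < N) (-1) ^+ n * z ^+ (n.*2.+1) / (n.*2.+1)`!%:R.

Lemma two_i_neq0 : (2 * 'i : R[i]) != 0.
Proof. by rewrite mulf_neq0 ?pnatr_eq0 // eq_complex /= oner_eq0 andbF. Qed.

(** Even powers cancel and odd powers double, so N terms of the sine series match 2 N terms of each
    exponential series; this carries [cexp_taylor] over to the sine. *)
Lemma csin_partialE N z :
  csin_partial N z * (2 * 'i) =
  \sum_(k < N.*2) ('i * z) ^+ k / k`!%:R - \sum_(k < N.*2) (- 'i * z) ^+ k / k`!%:R.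
Proof.
elim: N => [|N IH]; first by rewrite /csin_partial !big_ord0 mul0r subrr.
rewrite doubleS !big_ord_recr /= /csin_partial big_ord_recr /= mulrDl.
rewrite -/(csin_partial N z) IH.
have i2 : 'i ^+ 2 = -1 :> R[i] by exact: sqr_i.
have e1 : ('i * z) ^+ N.*2 = (-1) ^+ N * z ^+ N.*2.
  by rewrite exprMn -muln2 mulnC exprM i2.
have e2 : (- 'i * z) ^+ N.*2 = (-1) ^+ N * z ^+ N.*2.
  by rewrite exprMn -muln2 mulnC exprM sqrrN i2.
rewrite !exprS e1 e2; ring.
Qed.

Lemma csin_taylor N z : cabs (csin z - csin_partial N z) <=
  expR (cabs z) * cabs z ^+ N.*2 / (N.*2)`!%:R.
Proof.
have i1 : cabs ('i : R[i]) = 1 by rewrite /cabs /= expr0n add0r expr1n sqrtr1.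
have -> : csin z - csin_partial N z =
  ((cexp ('i * z) - \sum_(k < N.*2) ('i * z) ^+ k / k`!%:R) -
  (cexp (- 'i * z) - \sum_(k < N.*2) (- 'i * z) ^+ k / k`!%:R)) / (2 * 'i).
  apply: (mulIf two_i_neq0); rewrite divfK ?two_i_neq0 // mulrBl csin_partialE.
  by rewrite /csin divfK ?two_i_neq0 //; ring.
rewrite cabsM cabsV cabsM i1 mulr1 natC cabs_real ger0_norm //.
rewrite ler_pdivrMr //; apply: le_trans (ler_cabsB _ _) _.
have := cexp_taylor N.*2 ('i * z); have := cexp_taylor N.*2 (- 'i * z).
by rewrite !cabsM cabsN i1 !mul1r; lra.
Qed.

Lemma exp_partial_le (x : R) n : 0 <= x -> \sum_(k < n) x ^+ k / k`!%:R <= expR x.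
Proof.
move=> x0; rewrite -(big_mkord xpredT (fun k => x ^+ k / k`!%:R)).
have := @nondecreasing_cvgn_le R (series (exp_coeff x)) _ (is_cvg_series_exp_coeff x) n.
apply; apply/nondecreasing_seqP => m; rewrite /series /= big_nat_recr //= lerDl.
exact: exp_coeff_ge0.
Qed.

(** The bound is uniform in N, as domination requires. The factor |z|, due to the zero of the sine
    at 0, becomes an additional exp v in the Mellin integral and extends convergence from Re s > 0
    to Re s > -1. *)
Lemma cabs_csin_partial N z : cabs (csin_partial N z) <= cabs z * expR (cabs z).
Proof.
set x := cabs z; have x0 : 0 <= x by exact: cabs_ge0.
apply: (@le_trans _ _ (x * \sum_(k < N.*2) x ^+ k / k`!%:R)); last first.
  by rewrite ler_wpM2l // exp_partial_le.
elim: N => [|N IH]; first by rewrite /csin_partial !big_ord0 cabs0 mulr0.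
rewrite doubleS !big_ord_recr /= /csin_partial big_ord_recr /= mulrDr mulrDr.
rewrite -/(csin_partial N z); apply: le_trans (ler_cabsD _ _) _.
have t1 : cabs ((-1) ^+ N * z ^+ N.*2.+1 / (N.*2.+1)`!%:R) <= x * (x ^+ N.*2 / (N.*2)`!%:R).
  rewrite cabsM cabsV cabsM !cabsX natC cabs_real ger0_norm //.
  have c1 : cabs (1 : R[i]) = 1 by rewrite (cabs_real (1 : R)) normr1.
  rewrite cabsN c1 expr1n mul1r exprS -/x -mulrA.
  rewrite ler_wpM2l // ler_wpM2l ?exprn_ge0 // lef_pV2 ?posrE ?ltr0n ?fact_gt0 //.
  by rewrite ler_nat factS leq_pmull.
have t2 : 0 <= x * (x ^+ N.*2.+1 / (N.*2.+1)`!%:R) by rewrite mulr_ge0 // divr_ge0 // exprn_ge0.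
by move: t1 t2 IH; lra.
Qed.

Lemma csin_partial_cvg z : cabs (csin_partial N z - csin z) @[N --> \oo] --> (0 : R).
Proof.
have h : expR (cabs z) * cabs z ^+ N.*2 / (N.*2)`!%:R @[N --> \oo] --> (0 : R).
  rewrite -[0 in X in _ --> X](mulr0 (expR (cabs z))).
  under eq_fun do rewrite -mulrA.
  apply: cvgM; first exact: cvg_cst.
  have c0 := cvg_series_cvg_0 (is_cvg_series_exp_coeff (cabs z)).
  apply: (cvg_comp _ _ _ c0).
  move=> A [N _ NA]; exists N => // n /= Nn; apply: NA => /=.
  by rewrite (leq_trans Nn) // -addnn leq_addr.
apply: (squeeze_cvgr _ (cvg_cst 0) h); apply: nearW => N.
by rewrite cabs_ge0 /= -cabsN opprB csin_taylor.
Qed.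

Lemma cabs_le_cvg (u : nat -> R[i]) (l : R[i]) (B : R) :
  cabs (u n - l) @[n --> \oo] --> (0 : R) -> (forall n, cabs (u n) <= B) -> cabs l <= B.
Proof.
move=> ul uB; have h : B + cabs (u n - l) @[n --> \oo] --> B.
  by rewrite -[B in X in _ --> X]addr0; apply: cvgD => //; exact: cvg_cst.
rewrite -(cvg_lim _ h) //; apply: limr_ge; first by apply/cvg_ex; exists B.
apply: nearW => n; have := ler_cabsB (u n) (u n - l).
by rewrite subKr => /le_trans; apply; rewrite lerD2r.
Qed.

(** The bridge from [cabs] to the topology of [R[i]^o], in which [hyp1F1] is a limit. A positive
    radius in [R[i]] is necessarily real, so it can be compared with [cabs]. *)
Lemma limn_cabs (u : nat -> R[i]) (l : R[i]) :
  cabs (u n - l) @[n --> \oo] --> (0 : R) ->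
  limn (u : nat -> (R[i])^o) = l.
Proof.
move=> ul; apply: cvg_lim; first exact: norm_hausdorff.
apply/cvgrPdist_lt => e e0.
have er : e = (complex.Re e)%:C by case: (e) e0 => p q; rewrite ltcE /= => /andP[/eqP -> _].
have e0' : 0 < complex.Re e by move: e0; rewrite ltcE /= => /andP[].
have [N _ HN] := (@cvgr0Pnorm_lt _ R^o _ _ _ _).1 ul _ e0'.
exists N => // n Nn; have := HN n Nn; rewrite /= ger0_norm ?cabs_ge0 // => h.
by rewrite [`|_|]cabs_norm er ltcR -cabsN opprB.
Qed.

(** The origin of the parameter 3/2 and of the division of w^2 by 4: the odd factorials of the sine
    series, split into even and odd factors. *)
Lemma fact_pochhammer n :
  ((n.*2.+1)`!%:R : R[i]) = 4 ^+ n * n`!%:R * pochhammer (3 / 2) n.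
Proof.
elim: n => [|n IH]; first by rewrite /pochhammer big_geq // !mulr1.
have -> : (n.+1.*2.+1)`! = (n.*2.+3 * (n.*2.+2 * (n.*2.+1)`!))%N by rewrite doubleS factS factS.
rewrite natrM [(n.*2.+2 * _)%:R]natrM IH (factS n) [(n.+1 * n`!)%:R]natrM.
rewrite /pochhammer big_nat_recr //= exprS.
have -> : n.*2.+3%:R = 2 * n%:R + 3 :> R[i] by rewrite -[n.*2.+3]addn3 natrD -muln2 natrM mulrC.
have -> : n.*2.+2%:R = 2 * n%:R + 2 :> R[i] by rewrite -[n.*2.+2]addn2 natrD -muln2 natrM mulrC.
by rewrite -[n.+1%:R]natr1; field.
Qed.

Lemma pochhammer32_neq0 n : pochhammer (3 / 2 : R[i]) n != 0.
Proof.
have := @fact_pochhammer n; case: eqVneq => // ->; rewrite mulr0 => /eqP.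
by rewrite pnatr_eq0 => h; have := fact_gt0 n.*2.+1; rewrite lt0n h.
Qed.

End SineSeries.

(** * The function H, its majorants and its Mellin transform *)

Section SineKernel.
Variable R : realType.
Notation RR := (measurableTypeR R).
Implicit Types (z w x s xi : R[i]).

Definition hker w z : R[i] := cexp (- cexp (2 * z)) * csin (w * cexp z).

Definition hker_partial N w z : R[i] := cexp (- cexp (2 * z)) * csin_partial N (w * cexp z).

Lemma ccont_line_add xi : @ccont R R (fun v => v%:C + xi).
Proof. by apply: ccontD; [apply: ccont_real => x; exact: cvg_id|exact: ccont_cst]. Qed.

Lemma ccont_cexp_line s : @ccont R R (fun v => cexp (s * v%:C)).
Proof.
apply: ccont_cexp; apply: ccontM; first exact: ccont_cst.
by apply: ccont_real => x; exact: cvg_id.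
Qed.

Lemma ccont_csin (T : topologicalType) (f : T -> R[i]) : ccont f -> ccont (fun t => csin (f t)).
Proof.
move=> cf; apply: ccontM; last exact: ccont_cst.
apply: ccontD; last apply: ccontN.
  by apply: ccont_cexp; apply: ccontM => //; exact: ccont_cst.
by apply: ccont_cexp; apply: ccontM => //; exact: ccont_cst.
Qed.

Lemma ccont_gauss (T : topologicalType) (f : T -> R[i]) : ccont f ->
  ccont (fun t => cexp (- cexp (2 * f t))).
Proof.
move=> cf; apply: ccont_cexp; apply: ccontN; apply: ccont_cexp.
by apply: ccontM => //; exact: ccont_cst.
Qed.

Lemma ccont_hker (T : topologicalType) w (f : T -> R[i]) : ccont f ->
  ccont (fun t => hker w (f t)).
Proof.
move=> cf; apply: ccontM; first exact: ccont_gauss.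
by apply: ccont_csin; apply: ccontM; [exact: ccont_cst|exact: ccont_cexp].
Qed.

Lemma ccont_hker_partial (T : topologicalType) N w (f : T -> R[i]) : ccont f ->
  ccont (fun t => hker_partial N w (f t)).
Proof.
move=> cf; apply: ccontM; first exact: ccont_gauss.
apply: (ccont_sum (f := fun n t => (-1) ^+ n * (w * cexp (f t)) ^+ (n.*2.+1) / (n.*2.+1)`!%:R)).
move=> n; apply: ccontM; last exact: ccont_cst.
apply: ccontM; first exact: ccont_cst.
by apply: ccontX; apply: ccontM; [exact: ccont_cst|exact: ccont_cexp].
Qed.

Lemma hker_partial_cvg w z : cabs (hker_partial N w z - hker w z) @[N --> \oo] --> (0 : R).
Proof.
rewrite -[0 in X in _ --> X](mulr0 (cabs (cexp (- cexp (2 * z))))).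
under eq_fun do rewrite -mulrBr cabsM.
by apply: cvgM; [exact: cvg_cst|exact: csin_partial_cvg].
Qed.

(** One majorant serves all truncations, so it justifies termwise integration and passes to the
    limit [hker]. The modulus of the Gaussian factor is exp(-de exp(2 v)), with de > 0 because |2 Im
    xi| < pi/2. *)
Lemma hker_partial_lor s w xi : -1 < complex.Re s -> `|complex.Im xi| < pi / 4 ->
  exists2 C : R, 0 <= C & forall N v,
    cabs (cexp (s * v%:C) * hker_partial N w (v%:C + xi)) <= C * lor v.
Proof.
move=> s1 xp.
have c0 : 0 < cos (2 * complex.Im xi).
  by apply: cos_gt0_pihalf; move: xp; rewrite ltr_norml => /andP[? ?]; apply/andP; split; lra.
pose b := expR (complex.Re xi); pose de := b ^+ 2 * cos (2 * complex.Im xi).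
have b0 : 0 < b by exact: expR_gt0.
have de0 : 0 < de by rewrite mulr_gt0 // exprn_gt0.
pose A := cabs w * b.
have A0 : 0 <= A by rewrite mulr_ge0 ?cabs_ge0 // ltW.
have al0 : 0 < complex.Re s + 1 by lra.
have de1 : 0 < 3 * de / 4 by rewrite divr_gt0 // mulr_gt0.
have [C C0 HC] := expR_sub_expR_lor al0 de1.
exists (A * expR (A ^+ 2 / de + de) * C).
  by rewrite mulr_ge0 // mulr_ge0 ?expR_ge0.
move=> N v; pose y := expR v.
have y0 : 0 < y by exact: expR_gt0.
have cW : cabs (w * cexp (v%:C + xi)) = A * y.
  by rewrite cabsM cabs_cexp Re_add Re_real expRD /A -/y -/b; ring.
have cG : cabs (cexp (- cexp (2 * (v%:C + xi)))) = expR (- (de * y ^+ 2)).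
  rewrite cabs_cexp Re_opp Re_cexp; congr (expR (- _)).
  have -> : complex.Re (2 * (v%:C + xi)) = (v + v) + (complex.Re xi + complex.Re xi).
    by rewrite mulr_natl mulr2n !ReImE; ring.
  have -> : complex.Im (2 * (v%:C + xi)) = 2 * complex.Im xi.
    by rewrite mulr_natl mulr2n !ReImE; ring.
  by rewrite !expRD /de -/y -/b; ring.
have cS : cabs (cexp (s * v%:C)) = expR (complex.Re s * v).
  by rewrite cabs_cexp Re_mul Re_real Im_real mulr0 subr0.
rewrite cabsM cS cabsM cG.
have := cabs_csin_partial N (w * cexp (v%:C + xi)); rewrite cW => hp.
have h1 := ler_wpM2l (expR_ge0 (- (de * y ^+ 2))) hp.
have h2 := ler_wpM2l (expR_ge0 (complex.Re s * v)) h1.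
apply: le_trans h2 _.
have -> : expR (complex.Re s * v) * (expR (- (de * y ^+ 2)) * (A * y * expR (A * y))) =
  A * expR ((complex.Re s + 1) * v - de * y ^+ 2 + A * y).
  rewrite mulrDl mul1r !expRD -/y; ring.
have -> : A * expR (A ^+ 2 / de + de) * C * lor v =
  A * (expR (A ^+ 2 / de + de) * (C * lor v)) by ring.
rewrite ler_wpM2l //; apply: le_trans (ler_wpM2l (expR_ge0 _) (HC v)).
rewrite -expRD ler_expR -/y.
(* The growth exp(A y) of the sine is absorbed by a quarter of the Gaussian decay, completing a
   square. Next, [g2] weakens the remaining y^2 to y, the form that [expR_sub_expR_lor] handles. *)
have g1 : A * y <= A ^+ 2 / de + de * y ^+ 2 / 4.
  rewrite -subr_ge0; have -> : A ^+ 2 / de + de * y ^+ 2 / 4 - A * y = (A / de - y / 2) ^+ 2 * de.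
    by field; rewrite gt_eqF.
  by rewrite mulr_ge0 ?sqr_ge0 // ltW.
have g2 : 3 * de / 4 * y <= 3 * de / 4 * y ^+ 2 + de.
  rewrite -subr_ge0; have -> : 3 * de / 4 * y ^+ 2 + de - 3 * de / 4 * y =
     de * (3 / 4 * (y - 1 / 2) ^+ 2 + 13 / 16) by field.
  by rewrite mulr_ge0 ?(ltW de0) // addr_ge0 // mulr_ge0 ?sqr_ge0.
lra.
Qed.

Lemma hker_lor s w xi : -1 < complex.Re s -> `|complex.Im xi| < pi / 4 ->
  exists2 C : R, 0 <= C & forall v,
    cabs (cexp (s * v%:C) * hker w (v%:C + xi)) <= C * lor v.
Proof.
move=> s1 xp; have [C C0 HC] := hker_partial_lor w s1 xp.
exists C => // v; apply: (cabs_le_cvg (u := fun N => cexp (s * v%:C) * hker_partial N w (v%:C + xi))).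
  rewrite -[0 in X in _ --> X](mulr0 (cabs (cexp (s * v%:C)))).
  under eq_fun do rewrite -mulrBr cabsM.
  by apply: cvgM; [exact: cvg_cst|exact: hker_partial_cvg].
by move=> n; exact: HC.
Qed.

Lemma ccont_mellin s w xi : @ccont R R (fun v => cexp (s * v%:C) * hker w (v%:C + xi)).
Proof.
by apply: ccontM; [exact: ccont_cexp_line|apply: ccont_hker; exact: ccont_line_add].
Qed.

Lemma cintegral_sum (f : nat -> RR -> R[i]) N : (forall n, cintegrable setT (f n)) ->
  cintegrable setT (fun v => \sum_(n < N) f n v) /\
  cintegral setT (fun v => \sum_(n < N) f n v) = \sum_(n < N) cintegral setT (f n).
Proof.
move=> fi; elim: N => [|N [i1 e1]].
  have -> : (fun v => \sum_(n < 0) f n v) = fun=> 0.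
    by apply/funext => v; rewrite big_ord0.
  rewrite big_ord0; split.
    apply: (cintegrable_lor (C := 0)); first exact: cmeas_cst.
    by move=> v; rewrite cabs0 mul0r.
  by apply: complex_eq; rewrite /= Rintegral_cst // mul0r.
have -> : (fun v => \sum_(n < N.+1) f n v) = (fun v => \sum_(n < N) f n v + f N v).
  by apply/funext => v; rewrite big_ord_recr.
split; first exact: cintegrableD.
by rewrite (cintegralD measurableT i1 (fi N)) e1 big_ord_recr.
Qed.

(** Since 2 a = 1 + s + 2 n for a = (1 + s)/2 + n, the integrand is [gline a] at 2(v + xi), up to
    exp(-s xi). Doubling the variable produces the factor 1/2 and turns the bound pi/4 on Im xi into
    the bound pi/2 of [cintegral_gline_shift]. *)
Lemma mellin_term s xi n : -1 < complex.Re s -> `|complex.Im xi| < pi / 4 ->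
  let f (v : RR) := cexp (s * v%:C) * (cexp (- cexp (2 * (v%:C + xi))) * cexp (v%:C + xi) ^+ (n.*2.+1)) in
  cintegrable setT f /\
  cintegral setT f = cexp (- s * xi) * (cGamma ((1 + s) / 2 + n%:R) / 2).
Proof.
move=> s1 xp f; pose a := (1 + s) / 2 + n%:R.
have a0 : 0 < complex.Re a.
  rewrite /a Re_add natC Re_real ltr_wpDr //.
  have -> : (1 + s) / 2 = (2^-1 : R)%:C * (1 + s) by rewrite fmorphV rmorph_nat mulrC.
  by rewrite !ReImE mul0r subr0 /= mulr_gt0 // ; lra.
have x2 : `|complex.Im (2 * xi)| < pi / 2.
  rewrite mulr_natl mulr2n Im_add; move: xp; rewrite !ltr_norml => /andP[? ?].
  by apply/andP; split; lra.
have [i1 e1] := cintegral_gline_shift a0 x2.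
have cg : @ccont R R (fun v => gline a (v%:C + 2 * xi)).
  apply: ccont_cexp; apply: ccontD.
    by apply: ccontM; [exact: ccont_cst|exact: ccont_line_add].
  by apply: ccontN; apply: ccont_cexp; exact: ccont_line_add.
have [i2 e2] := cintegral_affine (k := 2) 0 (ltr0Sn _ _) cg i1.
have fE v : f v = cexp (- s * xi) * gline a ((2 * v + 0)%:C + 2 * xi).
  rewrite /f -cexpMn -!cexpD /gline.
  have -> : (2 * v + 0)%:C + 2 * xi = 2 * (v%:C + xi).
    by rewrite addr0 rmorphM rmorph_nat mulrDr.
  congr cexp.
  by rewrite /a -[n.*2.+1%:R]natr1 -muln2 natrM; field.
rewrite (_ : f = (fun v => cexp (- s * xi) * gline a ((2 * v + 0)%:C + 2 * xi))); last exact/funext.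
split; first exact: (cintegrableZ _ measurableT i2).
rewrite (cintegralZ _ measurableT i2); congr (_ * _).
rewrite -/a -e1 e2 rmorph_nat mulrAC mulfV ?mul1r // pnatr_eq0.
Qed.

(** The integrals of the truncations are a constant times the partial sums of the 1F1 series.
    Dominated convergence makes them tend to the integral of [hker], which, for a nonzero constant,
    proves convergence of the series and gives its sum at once. *)
Lemma mellin_hker s w xi : -1 < complex.Re s -> `|complex.Im xi| < pi / 4 -> w != 0 ->
  cintegral setT (fun v : RR => cexp (s * v%:C) * hker w (v%:C + xi)) =
  cexp (- s * xi) * (w / 2) * (cGamma ((1 + s) / 2) *
    hyp1F1 ((1 + s) / 2) (3 / 2) (- (w ^+ 2 / 4))).
Proof.
move=> s1 xp w0; set a := (1 + s) / 2; set M := cintegral _ _.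
have a0 : 0 < complex.Re a.
  have -> : a = (2^-1 : R)%:C * (1 + s) by rewrite fmorphV rmorph_nat mulrC.
  by rewrite !ReImE mul0r subr0 /= mulr_gt0 //; lra.
pose F N (v : RR) := cexp (s * v%:C) * hker_partial N w (v%:C + xi).
pose T (n : nat) := pochhammer a n / pochhammer (3 / 2) n * (- (w ^+ 2 / 4)) ^+ n / n`!%:R.
pose ka := cexp (- s * xi) * (w / 2).
have IF N : cintegral setT (F N) = ka * cGamma a * series T N.
  pose t n (v : RR) := cexp (s * v%:C) * (cexp (- cexp (2 * (v%:C + xi))) * cexp (v%:C + xi) ^+ (n.*2.+1)).
  pose k n := (-1) ^+ n * w ^+ (n.*2.+1) / (n.*2.+1)`!%:R.
  have FE v : F N v = \sum_(n < N) k n * t n v.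
    rewrite /F /hker_partial /csin_partial !mulr_sumr; apply: eq_bigr => n _.
    by rewrite /k /t exprMn; ring.
  rewrite (eq_cintegralT FE).
  have ti n : cintegrable setT (fun v : RR => k n * t n v).
    by apply: (cintegrableZ _ measurableT); have [] := mellin_term n s1 xp.
  have [_ ->] := cintegral_sum N ti.
  rewrite /series /= big_mkord mulr_sumr; apply: eq_bigr => n _.
  have [i1 e1] := mellin_term n s1 xp.
  rewrite (cintegralZ _ measurableT i1) e1 -/a cGamma_pochhammer // /ka /T /k.
  rewrite fact_pochhammer.
  have -> : (- (w ^+ 2 / 4)) ^+ n = (-1) ^+ n * w ^+ n.*2 / 4 ^+ n.
    by rewrite [LHS]exprNn [X in _ * X = _]expr_div_n -exprM mul2n mulrA.
  rewrite exprS; field.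
  by rewrite pochhammer32_neq0 expf_neq0 ?pnatr_eq0 // -lt0n fact_gt0.
have [C C0 HC] := hker_partial_lor w s1 xp.
have FM : cabs (ka * cGamma a * series T N - M) @[N --> \oo] --> (0 : R).
  under eq_fun do rewrite -IF.
  apply: (cintegral_dominated measurableT _ _ (integrable_lorZ C)).
  - move=> n; apply: ccont_cmeas => //; apply: ccontM; first exact: ccont_cexp_line.
    by apply: ccont_hker_partial; exact: ccont_line_add.
  - by apply: ccont_cmeas => //; exact: ccont_mellin.
  - by move=> n x _; exact: HC.
  move=> v _; rewrite -[0 in X in _ --> X](mulr0 (cabs (cexp (s * v%:C)))).
  under eq_fun do rewrite -mulrBr cabsM.
  by apply: cvgM; [exact: cvg_cst|exact: hker_partial_cvg].
rewrite -/ka mulrA.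
(* If Gamma a = 0, both sides vanish and the value of the series is irrelevant;
   so no nonvanishing result for Gamma is needed. *)
have [g0|gn] := eqVneq (cGamma a) 0.
  rewrite g0 mulr0 mul0r; apply: (cvg_cabs_unique FM).
  under eq_fun do rewrite g0 mulr0 mul0r subr0 cabs0.
  exact: cvg_cst.
have kn : ka * cGamma a != 0.
  apply: mulf_neq0 => //; apply: mulf_neq0; first exact: cexp_neq0.
  by rewrite mulf_neq0 // invr_neq0 // pnatr_eq0.
have -> : hyp1F1 a (3 / 2) (- (w ^+ 2 / 4)) = M / (ka * cGamma a).
  apply: limn_cabs.
  rewrite -[0 in X in _ --> X](mul0r (cabs (ka * cGamma a))^-1).
  have e N : cabs (series T N - M / (ka * cGamma a)) =
    cabs (ka * cGamma a * series T N - M) * (cabs (ka * cGamma a))^-1.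
    by rewrite -cabsV -cabsM; congr cabs; rewrite mulrBl [_ * series T N]mulrC mulfK.
  under eq_fun do rewrite e.
  by apply: cvgM => //; exact: cvg_cst.
by rewrite mulrC divfK.
Qed.

End SineKernel.

(** * Fourier inversion *)

Section Poisson.
Variable R : realType.
Notation mu := (@lebesgue_measure R).
Notation RR := (measurableTypeR R).
Implicit Types (lam x : R[i]) (q t : R).

Lemma carg_lt_pihalf x : 0 < complex.Re x -> `|carg x| < pi / 2.
Proof.
move=> x0; have xn : x != 0 by apply/eqP => x00; rewrite x00 ltxx in x0.
have c0 : 0 < cabs x by rewrite cabs_gt0.
have bd := cln_real_bounds xn.
have -> : `|carg x| = acos (complex.Re x / cabs x).
  by rewrite /carg; case: ifP => _; rewrite ?normrN ger0_norm // acos_ge0.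
rewrite -(@ltr_cos R) ?in_itv /= ?acos_ge0 ?acos_lepi //.
  by rewrite cos_pihalf acosK ?in_itv //= divr_gt0.
by have := pi_gt0 R => p0; apply/andP; split; lra.
Qed.

Lemma cGamma1 : cGamma (1 : R[i]) = 1.
Proof.
rewrite /cGamma (eq_cintegral (g := fun t : RR => (expR (- t))%:C)); last first.
  move=> t _; rewrite subrr /cpow mul0r cexp0 mul1r.
  by rewrite -[- t%:C]/((- t +i* - 0)) oppr0 -[_ +i* 0]/((- t)%:C) cexp_real.
apply: complex_eq => /=; last by rewrite Rintegral_cst ?mul0r.
rewrite /Rintegral.
have me : measurable_fun [set: RR] (fun t : RR => expR (- t)).
  by apply: measurableT_comp => //; exact: measurable_oppr.
rewrite integral_itv_obnd_cbnd; last by apply/measurable_EFinP; exact: measurable_funTS.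
have := @integral_exponential_pdf R 1 ltr01.
rewrite /exponential_pdf => h.
have -> : (\int[mu]_(t in `[0%R, +oo[) (expR (- t))%:E = 1)%E; last by [].
rewrite -h integral_mkcond; apply: eq_integral => t _.
rewrite restrict_EFin /= /patch; case: ifP => // _.
by rewrite mul1r mulN1r.
Qed.

(** Euler's integral for a = 1, shifted by xi = log lam: Re lam > 0 means |Im xi| < pi/2, and the
    shifted integrand becomes lam exp(-lam t) under t = exp v. *)
Lemma cintegral_exp_halfline lam : 0 < complex.Re lam ->
  cintegral `]0, +oo[ (fun t : RR => cexp (- (lam * t%:C))) = lam^-1.
Proof.
move=> l0; have ln0 : lam != 0 by apply/eqP => x00; rewrite x00 ltxx in l0.
have a0 : 0 < complex.Re (1 : R[i]) by exact: ltr01.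
have xp : `|complex.Im (cln lam)| < pi / 2 by exact: carg_lt_pihalf.
have [i1 e1] := cintegral_gline_shift a0 xp.
have cg : @ccont R R (fun v => gline 1 (v%:C + cln lam)).
  apply: ccont_cexp; apply: ccontD.
    by apply: ccontM; [exact: ccont_cst|exact: ccont_line_add].
  by apply: ccontN; apply: ccont_cexp; exact: ccont_line_add.
have [i2 e2] := cintegral_exp cg i1.
have fE t : `]0, +oo[%classic t ->
    gline 1 ((ln t)%:C + cln lam) * (t^-1)%:C = lam * cexp (- (lam * t%:C)).
  rewrite /= in_itv /= andbT => t0.
  have ec : cexp ((ln t)%:C + cln lam) = t%:C * lam.
    by rewrite cexpD cexp_cln // cexp_real lnK.
  rewrite /gline mul1r ec cexpD ec fmorphV [lam * t%:C]mulrC; field.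
  by rewrite eq_complex /= eqxx andbT gt_eqF.
have m0 : measurable (`]0, +oo[%classic : set RR) by exact: measurable_itv.
have i3 := cintegrable_eq m0 fE i2.
have i4 : cintegrable (`]0, +oo[ : set RR) (fun t : RR => cexp (- (lam * t%:C))).
  by apply: cintegrable_eq (cintegrableZ lam^-1 m0 i3) => // t _; rewrite mulKf.
apply: (mulfI ln0); rewrite divff // -(cintegralZ lam m0 i4) -cGamma1 -e1 e2.
by apply: eq_cintegral => t t0; rewrite fE.
Qed.

Definition osc (t : R) : R[i] := cexp (0 +i* t).

Lemma cabs_osc t : cabs (osc t) = 1.
Proof. by rewrite cabs_cexp /= expR0. Qed.

Lemma oscD t q : osc (t + q) = osc t * osc q.
Proof. by rewrite /osc -cexpD; congr cexp; apply: complex_eq; rewrite /= ?addr0. Qed.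

Lemma ccont_osc (T : topologicalType) (f : T -> R) : continuous f -> ccont (fun u => osc (f u)).
Proof. by move=> cf; apply: ccont_cexp; apply: ccont_line => // x; exact: cvg_cst. Qed.

Lemma cmeas_osc d (T : measurableType d) (f : T -> R) : measurable_fun setT f ->
  cmeas setT (fun u => osc (f u)).
Proof. by move=> mf; apply: cmeas_cexp; apply: cmeas_line => //; exact: measurable_cst. Qed.

Definition poisson q t : R[i] := osc (q * t) * (expR (- `|t|))%:C.

Lemma continuous_expRN_norm (k : R) : continuous (fun t : R => expR (- (k * `|t|)) : R).
Proof.
move=> x; apply: (@continuous_comp _ _ _ (fun t : R => - (k * `|t|)) expR); last exact: continuous_expR.
by apply: cvgN; apply: cvgM; [exact: cvg_cst|apply: cvg_norm; exact: cvg_id].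
Qed.

Lemma continuous_mulr (q : R) : continuous (fun t : R => q * t : R).
Proof. by move=> x; apply: cvgM; [exact: cvg_cst|exact: cvg_id]. Qed.

Lemma ccont_poisson q : @ccont R R (poisson q).
Proof.
apply: ccontM; first by apply: ccont_osc; exact: continuous_mulr.
apply: ccont_real; have := @continuous_expRN_norm 1.
by under eq_fun do rewrite mul1r.
Qed.

Lemma cintegrable_poisson q : cintegrable setT (poisson q : RR -> R[i]).
Proof.
have [C C0 HC] := expRN_lor (@ltr01 R).
apply: (cintegrable_lor (C := C)); first by apply: ccont_cmeas => //; exact: ccont_poisson.
move=> v; rewrite cabsM cabs_osc mul1r cabs_real ger0_norm ?expR_ge0 //.
by have := HC v; rewrite mul1r.
Qed.

Lemma cintegrableS (D E : set RR) (f : RR -> R[i]) : measurable D -> measurable E ->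
  D `<=` E -> cintegrable E f -> cintegrable D f.
Proof. by move=> mD mE DE [f1 f2]; split; apply: (integrableS mE). Qed.

Lemma cintegral_poisson_half q :
  cintegral `]0, +oo[ (poisson q : RR -> R[i]) = (1 -i* q)^-1.
Proof.
rewrite -cintegral_exp_halfline ?ltr01 //; apply: eq_cintegral => t /=.
rewrite in_itv /= andbT => t0; rewrite /poisson gtr0_norm // -cexp_real -cexpD.
congr cexp; apply: complex_eq; rewrite !ReImE /=.
  by rewrite mulr0 subr0 mul1r; exact: add0r.
by rewrite addr0 mulr0 add0r mulNr opprK.
Qed.

(** The half-lines contribute 1/(1 - i q) and, after reflection, 1/(1 + i q). *)
Lemma cintegral_poisson q : cintegral setT (poisson q : RR -> R[i]) = (2 * lor q)%:C.
Proof.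
have iq := cintegrable_poisson q; have iNq := cintegrable_poisson (- q).
have m1 : measurable (`]-oo, 0] : set RR) by exact: measurable_itv.
have m2 : measurable (`]0, +oo[ : set RR) by exact: measurable_itv.
have m3 : measurable (`[0, +oo[ : set RR) by exact: measurable_itv.
have U : [set: RR] = `]-oo, 0]%classic `|` `]0, +oo[%classic.
  apply/seteqP; split => // t _; rewrite /= !in_itv /= andbT.
  by have [t0|t0] := leP t 0; [left|right].
have dis : [disjoint (`]-oo, 0]%classic : set RR) & `]0, +oo[%classic].
  rewrite disj_set2E; apply/eqP; rewrite -subset0 => t /=.
  by rewrite !in_itv /= andbT leNgt => -[/negP].
have e1 : cintegral setT (poisson q : RR -> R[i]) =
    cintegral `]-oo, 0] (poisson q : RR -> R[i]) + cintegral `]0, +oo[ (poisson q : RR -> R[i]).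
  have [j1 j2] := iq; rewrite U in j1 j2 *.
  by apply: complex_eq; rewrite ?Re_add ?Im_add /= Rintegral_setU.
have [_ e2] := cintegral_reflect (ccont_poisson (- q)) (cintegrableS m3 measurableT (@subsetT _ _) iNq).
have e3 : cintegral `]-oo, 0] (poisson q : RR -> R[i]) = cintegral `[0, +oo[ (poisson (- q) : RR -> R[i]).
  by rewrite e2; apply: eq_cintegral => t _; rewrite /poisson mulrNN normrN.
have e4 : cintegral `[0, +oo[ (poisson (- q) : RR -> R[i]) = cintegral `]0, +oo[ (poisson (- q) : RR -> R[i]).
  have [j1 j2] := cintegrableS m2 measurableT (@subsetT _ _) iNq.
  by apply: complex_eq; rewrite /= Rintegral_itv_obnd_cbnd.
rewrite e1 e3 e4 !cintegral_poisson_half opprK /lor /oneDsqr.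
have q1 : 0 < 1 + q ^+ 2 by rewrite ltr_pwDl ?sqr_ge0.
apply: complex_eq; rewrite ?Re_add ?Im_add /=; field; rewrite ?sqrrN ?expr1n gt_eqF //.
Qed.

Lemma cintegral_poisson_scaled (e y : R) : 0 < e ->
  cintegral setT (fun t : RR => osc (t * y) * (expR (- (e * `|t|)))%:C) = (2 / e * lor (y / e))%:C.
Proof.
move=> e0; have [i1 e1] := cintegral_affine 0 e0 (ccont_poisson (y / e)) (cintegrable_poisson (y / e)).
have em : e^-1 * e = 1 by rewrite mulVf // gt_eqF.
have -> : (2 / e * lor (y / e))%:C = (e^-1)%:C * (2 * lor (y / e))%:C.
  by rewrite -rmorphM; congr (_%:C); ring.
rewrite -cintegral_poisson e1 mulrA -rmorphM em mul1r; apply: eq_cintegralT => t.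
rewrite /poisson addr0 normrM (gtr0_norm e0); congr (osc _ * _).
by field; rewrite gt_eqF.
Qed.

End Poisson.

(** * Inversion and Parseval's identity *)

Section Fourier.
Variable R : realType.
Notation mu := (@lebesgue_measure R).
Notation RR := (measurableTypeR R).
Implicit Types (F G : RR -> R[i]) (t v : R).

(** The sign is that of exp(+i t y), so that transforming exp(c v) H(v) evaluates the Mellin
    transform at c + i t. Inversion uses the same sign and therefore returns 2 pi times the value at
    -v. *)
Definition fourier G t : R[i] := cintegral setT (fun y : RR => G y * osc (t * y)).

Lemma cmeas_fst (f : RR -> R[i]) : cmeas setT f ->
  cmeas setT (fun z : RR * RR => f z.1).
Proof. by move=> [f1 f2]; split; [exact: (measurableT_comp f1 measurable_fst)|exact: (measurableT_comp f2 measurable_fst)]. Qed.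

Lemma cmeas_snd (f : RR -> R[i]) : cmeas setT f ->
  cmeas setT (fun z : RR * RR => f z.2).
Proof. by move=> [f1 f2]; split; [exact: (measurableT_comp f1 measurable_snd)|exact: (measurableT_comp f2 measurable_snd)]. Qed.

Lemma cmeas_osc_prod (b : R) : cmeas setT (fun z : RR * RR => osc (z.1 * (z.2 + b))).
Proof.
apply: cmeas_osc; apply: measurable_funM; first exact: measurable_fst.
by apply: measurable_funD; [exact: measurable_snd|exact: measurable_cst].
Qed.

(** Measurability in the parameter is extracted from Fubini: the weight exp(-|t|) makes the double
    integral absolutely convergent, and multiplication by exp |t| removes it afterwards. *)
Lemma cmeas_fourier G C : cmeas setT G -> (forall y, cabs (G y) <= C * lor y) ->
  cmeas setT (fourier G : RR -> R[i]).
Proof.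
move=> mG GC; have [K K0 HK] := expRN_lor (@ltr01 R).
pose f (z : RR * RR) := (expR (- `|z.1|))%:C * (G z.2 * osc (z.1 * (z.2 + 0))).
have ce : continuous (fun t : R => expR (- `|t|) : R).
  by have := @continuous_expRN_norm R 1; under eq_fun do rewrite mul1r.
have mf : cmeas setT f.
  apply: cmeasM; last by apply: cmeasM; [exact: cmeas_snd|exact: cmeas_osc_prod].
  apply: (@cmeas_fst (fun t => (expR (- `|t|))%:C)); apply: cmeas_real.
  exact: continuous_measurable_fun.
have [] := cintegral_fubini mf (integrable_lorZ K) (integrable_lorZ C) _.
  move=> x y; rewrite /f /= 2!cabsM cabs_osc mulr1 cabs_real ger0_norm ?expR_ge0 //.
  apply: ler_pM; rewrite ?expR_ge0 ?cabs_ge0 //.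
  by have := HK x; rewrite mul1r.
move=> /cintegrable_meas m1 _.
have iG t : cintegrable setT (fun y : RR => G y * osc (t * (y + 0))).
  apply: (cintegrable_lor (C := C)).
    apply: (cmeasM mG); apply: cmeas_osc.
    apply: continuous_measurable_fun => y; apply: cvgM; first exact: cvg_cst.
    by apply: cvgD; [exact: cvg_id|exact: cvg_cst].
  by move=> v; rewrite cabsM cabs_osc mulr1.
have m2 : cmeas setT (fun t : RR => (expR `|t|)%:C).
  apply: cmeas_real; apply: continuous_measurable_fun => x.
  apply: (@continuous_comp _ _ _ (fun t : R => `|t|) expR); last exact: continuous_expR.
  by apply: cvg_norm; exact: cvg_id.
have := cmeasM m2 m1; congr cmeas; apply/funext => t.
have -> : cintegral setT (fun y : RR => f (t, y)) =
    (expR (- `|t|))%:C * cintegral setT (fun y : RR => G y * osc (t * (y + 0))).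
  by rewrite -(cintegralZ _ measurableT (iG t)); exact: eq_cintegralT.
rewrite mulrA -rmorphM -expRD subrr expR0 mul1r.
by rewrite /fourier; apply: eq_cintegralT => y; rewrite addr0.
Qed.

Lemma cvg_harmonic_scale (c : R) : expR (- (n.+1%:R^-1 * c)) @[n --> \oo] --> (1 : R).
Proof.
have h : - (n.+1%:R^-1 * c) @[n --> \oo] --> (0 : R).
  rewrite -[0 in X in _ --> X]oppr0; apply: cvgN.
  rewrite -[0 in X in _ --> X](mul0r c); apply: cvgM; last exact: cvg_cst.
  exact: cvg_harmonic.
rewrite -[1 in X in _ --> X](@expR0 R).
by apply: continuous_cvg => //; exact: continuous_expR.
Qed.

Lemma cvg_ccont G (u : nat -> R) (l : R) : @ccont R R G -> u n @[n --> \oo] --> l ->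
  cabs (G (u n) - G l) @[n --> \oo] --> (0 : R).
Proof.
move=> [g1 g2] ul; apply/cvg_cabs_ReIm; split.
  exact: (continuous_cvg _ (g1 l) ul).
exact: (continuous_cvg _ (g2 l) ul).
Qed.

(** The damping permits Fubini, the inner integral being the Poisson kernel of width e. The
    substitution y = e q - v normalises the kernel, so that e remains only in the argument of
    [G]. *)
Lemma fourier_damped G C (e v : R) : 0 < e -> @ccont R R G -> 0 <= C ->
  (forall y, cabs (G y) <= C * lor y) ->
  cintegral setT (fun t : RR => osc (t * v) * fourier G t * (expR (- (e * `|t|)))%:C) =
  cintegral setT (fun q : RR => G (e * q - v) * (2 * lor q)%:C).
Proof.
move=> e0 cG C0 GC; have mG : cmeas setT G by exact: ccont_cmeas.
have [K K0 HK] := expRN_lor e0.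
have ec : continuous (fun t : R => expR (- (e * `|t|)) : R) by exact: continuous_expRN_norm.
have mec : cmeas setT (fun t : RR => (expR (- (e * `|t|)))%:C).
  by apply: cmeas_real; exact: continuous_measurable_fun.
pose f (z : RR * RR) := (expR (- (e * `|z.1|)))%:C * (G z.2 * osc (z.1 * (z.2 + v))).
have mf : cmeas setT f.
  apply: cmeasM; first exact: (cmeas_fst mec).
  by apply: cmeasM; [exact: cmeas_snd|exact: cmeas_osc_prod].
have [] := cintegral_fubini mf (integrable_lorZ K) (integrable_lorZ C) _.
  move=> x y; rewrite /f /= 2!cabsM cabs_osc mulr1 cabs_real ger0_norm ?expR_ge0 //.
  by apply: ler_pM; rewrite ?expR_ge0 ?cabs_ge0.
move=> _ fub.
have iG t : cintegrable setT (fun y : RR => G y * osc (t * y)).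
  apply: (cintegrable_lor (C := C)).
    apply: (cmeasM mG); apply: cmeas_osc.
    by apply: continuous_measurable_fun; exact: continuous_mulr.
  by move=> y; rewrite cabsM cabs_osc mulr1.
have ip y : cintegrable setT (fun t : RR => osc (t * (y + v)) * (expR (- (e * `|t|)))%:C).
  apply: (cintegrable_lor (C := K)).
    apply: cmeasM; last exact: mec.
    apply: cmeas_osc; apply: continuous_measurable_fun => t.
    by apply: cvgM; [exact: cvg_id|exact: cvg_cst].
  by move=> t; rewrite cabsM cabs_osc mul1r cabs_real ger0_norm ?expR_ge0.
transitivity (cintegral setT (fun t : RR => cintegral setT (fun y : RR => f (t, y)))).
  apply: eq_cintegralT => t; rewrite /fourier mulrAC.
  rewrite -(cintegralZ _ measurableT (iG t)); apply: eq_cintegralT => y.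
  by rewrite /f /= mulrDr oscD; ring.
rewrite fub => {fub}.
transitivity (cintegral setT (fun y : RR => G y * (2 / e * lor ((y + v) / e))%:C)).
  apply: eq_cintegralT => y; rewrite -(cintegral_poisson_scaled _ e0).
  rewrite -(cintegralZ _ measurableT (ip y)); apply: eq_cintegralT => t.
  by rewrite /f /=; ring.
have cf : @ccont R R (fun y => G y * (2 / e * lor ((y + v) / e))%:C).
  apply: (ccontM cG); apply: ccont_real => y; apply: cvgM; first exact: cvg_cst.
  apply: (@continuous_comp _ _ _ (fun y : R => (y + v) / e) (@lor R)).
    apply: cvgM; last exact: cvg_cst.
    by apply: cvgD; [exact: cvg_id|exact: cvg_cst].
  exact: continuous_oneDsqrV.
have fi : cintegrable setT (fun y : RR => G y * (2 / e * lor ((y + v) / e))%:C).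
  apply: (cintegrable_lor (C := C * (2 / e))); first exact: ccont_cmeas.
  have e20 : 0 <= 2 / e by rewrite divr_ge0 // ltW.
  move=> y; rewrite cabsM cabs_real ger0_norm; last by rewrite mulr_ge0 ?lor_ge0.
  rewrite [leRHS]mulrAC; apply: ler_pM; rewrite ?cabs_ge0 ?(mulr_ge0 e20) ?lor_ge0 //.
  by rewrite ler_piMr ?lor_le1.
have [i2 ->] := cintegral_affine (- v) e0 cf fi.
rewrite -(cintegralZ _ measurableT i2); apply: eq_cintegralT => q.
rewrite subrK mulrCA; congr (_ * _); rewrite -rmorphM; congr (_%:C).
have -> : e * q / e = q by rewrite mulrAC mulfV ?mul1r // gt_eqF.
by field; rewrite gt_eqF.
Qed.

(* Poisson summability: damping by exp(-e|t|) turns the inverse transform into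
   the convolution of G with a Lorentzian of width e. *)
Lemma fourier_inversion G C C' v : @ccont R R G -> 0 <= C ->
  (forall y, cabs (G y) <= C * lor y) ->
  (forall t, cabs (fourier G t) <= C' * lor t) ->
  cintegral setT (fun t : RR => osc (t * v) * fourier G t) = (2 * pi)%:C * G (- v).
Proof.
move=> cG C0 GC GC'.
have mG : cmeas setT G by exact: ccont_cmeas.
have mGf := cmeas_fourier mG GC.
have mo : cmeas setT (fun t : RR => osc (t * v)).
  apply: cmeas_osc; apply: continuous_measurable_fun => t.
  by apply: cvgM; [exact: cvg_id|exact: cvg_cst].
pose e (n : nat) : R := n.+1%:R^-1.
have e0 n : 0 < e n by rewrite invr_gt0 ltr0n.
have ec n : continuous (fun t : R => expR (- (e n * `|t|)) : R) by exact: continuous_expRN_norm.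
pose A n (t : RR) := osc (t * v) * fourier G t * (expR (- (e n * `|t|)))%:C.
have e1 n t : expR (- (e n * `|t|)) <= 1.
  by rewrite -[leRHS]expR0 ler_expR oppr_le0 mulr_ge0 // ltW.
(* The same sequence gets two limits as e tends to 0: here from the Lorentzian bound on the
   transform, below from the continuity of [G] at -v. *)
have lim1 : cabs (cintegral setT (A n) - cintegral setT (fun t : RR => osc (t * v) * fourier G t))
    @[n --> \oo] --> (0 : R).
  apply: (cintegral_dominated measurableT _ _ (integrable_lorZ C')).
  - move=> n; apply: cmeasM; first exact: cmeasM.
    by apply: cmeas_real; exact: continuous_measurable_fun.
  - exact: cmeasM.
  - move=> n t _; rewrite /A 2!cabsM cabs_osc mul1r cabs_real ger0_norm ?expR_ge0 //.
    by apply: le_trans (GC' t); rewrite ler_piMr ?cabs_ge0.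
  move=> t _; have h (n : nat) : cabs (A n t - osc (t * v) * fourier G t) =
      cabs (fourier G t) * `|expR (- (e n * `|t|)) - 1|.
    have -> : A n t - osc (t * v) * fourier G t =
      osc (t * v) * fourier G t * (expR (- (e n * `|t|)) - 1)%:C.
      by rewrite rmorphB mulrBr rmorph1 mulr1.
    by rewrite cabsM cabsM cabs_osc mul1r cabs_real.
  have -> : (fun n => cabs (A n t - osc (t * v) * fourier G t)) =
    (fun n => cabs (fourier G t) * `|expR (- (e n * `|t|)) - 1|) by exact/funext.
  rewrite -[0 in X in _ --> X](mulr0 (cabs (fourier G t))); apply: cvgM; first exact: cvg_cst.
  rewrite -[0 in X in _ --> X](normr0 R) -(subrr (1 : R)); apply: cvg_norm.
  by apply: cvgB; [exact: cvg_harmonic_scale|exact: cvg_cst].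
pose B n (q : RR) := G (e n * q - v) * (2 * lor q)%:C.
have AB n : cintegral setT (A n) = cintegral setT (B n) by exact: (fourier_damped v (e0 n) cG C0 GC).
have lim2 : cabs (cintegral setT (A n) - cintegral setT (fun q : RR => G (- v) * (2 * lor q)%:C))
    @[n --> \oo] --> (0 : R).
  under eq_fun do rewrite AB.
  have ml : cmeas setT (fun q : RR => (2 * lor q)%:C).
    apply: cmeas_real; apply: continuous_measurable_fun => q.
    by apply: cvgM; [exact: cvg_cst|exact: continuous_oneDsqrV].
  apply: (cintegral_dominated measurableT _ _ (integrable_lorZ (C * 2))).
  - move=> n; apply: cmeasM; last exact: ml.
    apply: ccont_cmeas; first exact: measurableT.
    apply: (ccont_comp cG) => q.
    by apply: cvgB; [exact: continuous_mulr|exact: cvg_cst].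
  - by apply: cmeasM; [exact: cmeas_cst|exact: ml].
  - move=> n q _; rewrite cabsM cabs_real ger0_norm ?mulr_ge0 ?lor_ge0 //.
    rewrite -mulrA ler_wpM2r ?mulr_ge0 ?lor_ge0 //.
    by apply: le_trans (GC _) _; rewrite ler_piMr ?lor_le1.
  move=> q _.
  have h : e n * q - v @[n --> \oo] --> - v.
    rewrite -[- v in X in _ --> X]add0r; apply: cvgB; last exact: cvg_cst.
    rewrite -[0 in X in _ --> X](mul0r q); apply: cvgM; last exact: cvg_cst.
    exact: cvg_harmonic.
  have h2 : cabs (G (e n * q - v) - G (- v)) @[n --> \oo] --> (0 : R) by exact: cvg_ccont.
  rewrite -[0 in X in _ --> X](mul0r (cabs (2 * lor q)%:C)).
  under eq_fun do rewrite -mulrBl cabsM.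
  by apply: cvgM => //; exact: cvg_cst.
rewrite (cvg_cabs_unique lim1 lim2).
have il : cintegrable setT (fun q : RR => (lor q)%:C).
  apply: (cintegrable_lor (C := 1)).
    by apply: cmeas_real; apply: continuous_measurable_fun; exact: continuous_oneDsqrV.
  by move=> q; rewrite cabs_real ger0_norm ?lor_ge0 // mul1r.
have -> : (fun q : RR => G (- v) * (2 * lor q)%:C) = (fun q => G (- v) * 2%:C * (lor q)%:C).
  by apply/funext => q; rewrite rmorphM mulrA.
rewrite cintegralZ // rmorphM -mulrA mulrC; congr (_ * _ * _).
by apply: complex_eq; rewrite /= ?Rintegral_lor // Rintegral_cst ?mul0r.
Qed.

(** Expanding [fourier F] and exchanging the integrals leaves the inverse transform of [fourier G]
    inside. Decay is thus demanded of one transform, which is the role of the rotation applied to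
    [G]. *)
Lemma fourier_parseval F G CF C C' : cmeas setT F -> @ccont R R G -> 0 <= C ->
  (forall y, cabs (F y) <= CF * lor y) ->
  (forall y, cabs (G y) <= C * lor y) ->
  (forall t, cabs (fourier G t) <= C' * lor t) ->
  cintegrable setT (fun t : RR => fourier F t * fourier G t) /\
  cintegral setT (fun t : RR => fourier F t * fourier G t) =
  (2 * pi)%:C * cintegral setT (fun v : RR => F v * G (- v)).
Proof.
move=> mF cG C0 FC GC GC'.
have mG : cmeas setT G by exact: ccont_cmeas.
have mGf := cmeas_fourier mG GC.
pose f (z : RR * RR) := fourier G z.1 * (F z.2 * osc (z.1 * (z.2 + 0))).
have mf : cmeas setT f.
  apply: cmeasM; first exact: cmeas_fst.
  by apply: cmeasM; [exact: cmeas_snd|exact: cmeas_osc_prod].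
have [] := cintegral_fubini mf (integrable_lorZ C') (integrable_lorZ CF) _.
  move=> x y; rewrite /f /= 2!cabsM cabs_osc mulr1.
  by apply: ler_pM; rewrite ?cabs_ge0.
have iF t : cintegrable setT (fun y : RR => F y * osc (t * y)).
  apply: (cintegrable_lor (C := CF)).
    apply: cmeasM => //; apply: cmeas_osc.
    by apply: continuous_measurable_fun; exact: continuous_mulr.
  by move=> y; rewrite cabsM cabs_osc mulr1.
have e1 t : cintegral setT (fun y : RR => f (t, y)) = fourier F t * fourier G t.
  rewrite mulrC -(cintegralZ _ measurableT (iF t)); apply: eq_cintegralT => y.
  by rewrite /f /= addr0.
move=> i1 fub; split; first exact: (cintegrable_eqT e1 i1).
rewrite -(eq_cintegralT e1) fub => {i1 fub}.
have iFG : cintegrable setT (fun v : RR => F v * G (- v)).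
  apply: (cintegrable_lor (C := CF * C)).
    apply: cmeasM => //; apply: ccont_cmeas => //; apply: (@ccont_comp R R G) => // q.
    by apply: cvgN; exact: cvg_id.
  move=> y; rewrite cabsM mulrAC; apply: ler_pM; rewrite ?cabs_ge0 //.
  by apply: le_trans (GC _) _; rewrite ler_piMr ?lor_le1.
rewrite -cintegralZ //; apply: eq_cintegralT => y.
rewrite mulrCA -(fourier_inversion y cG C0 GC GC') -cintegralZ //.
  by apply: eq_cintegralT => t; rewrite /f /= addr0; ring.
apply: (cintegrable_lor (C := C')).
  apply: cmeasM => //; apply: cmeas_osc; apply: continuous_measurable_fun => t.
  by apply: cvgM; [exact: cvg_id|exact: cvg_cst].
by move=> t; rewrite cabsM cabs_osc mul1r.
Qed.

End Fourier.

(** * Proof of the theorem *)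

Section MellinPair.
Variable R : realType.

Lemma imagE (t : R) : 0 +i* t = 'i * t%:C.
Proof.
apply: complex_eq; rewrite ?Re_mul ?Im_mul /=; first by rewrite mul0r mul1r subr0.
by rewrite mul0r mul1r add0r.
Qed.

Lemma osc_cexp (s : R[i]) (t v : R) :
  cexp (s * v%:C) * osc (t * v) = cexp ((s + (0 +i* t)) * v%:C).
Proof. by rewrite /osc -cexpD !imagE rmorphM; congr cexp; ring. Qed.

Lemma lineD (c t : R) (s : R[i]) : c +i* t + s = c%:C + s + (0 +i* t).
Proof.
have -> : c +i* t = c%:C + 'i * t%:C by exact: complexE.
by rewrite (imagE t); ring.
Qed.

Notation RR := (measurableTypeR R).
Variables (z w xi : R[i]) (c : R).
Hypotheses (hz : -1 + complex.Re z < c) (hz' : -1 - complex.Re z < c).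
Hypotheses (w0 : w != 0) (hxi : `|complex.Im xi| < pi / 4).

Let F (v : RR) : R[i] := cexp ((c%:C + z) * v%:C) * hker w v%:C.
Let G (v : RR) : R[i] := cexp ((c%:C - z) * v%:C) * hker w (v%:C + xi).
Let Phi (s : R[i]) := cGamma ((1 + s) / 2) * hyp1F1 ((1 + s) / 2) (3 / 2) (- (w ^+ 2 / 4)).

Let reF : -1 < complex.Re (c%:C + z). Proof. by rewrite Re_add Re_real; have := hz'; lra. Qed.
Let reG : -1 < complex.Re (c%:C - z). Proof. by rewrite Re_add Re_opp Re_real; have := hz; lra. Qed.

(** The shift is kept free because three values occur: 0 for [F], log x for [G], and a purely
    imaginary one for the decay of the second transform. *)
Lemma fourier_mellin (s xi' : R[i]) (t : R) : -1 < complex.Re s -> `|complex.Im xi'| < pi / 4 ->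
  fourier (fun v : RR => cexp (s * v%:C) * hker w (v%:C + xi')) t =
  cexp (- (s + (0 +i* t)) * xi') * (w / 2) * Phi (s + (0 +i* t)).
Proof.
move=> s1 xp.
have s2 : -1 < complex.Re (s + (0 +i* t)) by rewrite Re_add /= addr0.
rewrite -(mellin_hker s2 xp w0); apply: eq_cintegralT => v.
by rewrite mulrAC osc_cexp.
Qed.

Lemma fourierF t : fourier F t = w / 2 * Phi (c +i* t + z).
Proof.
have xp : `|complex.Im (0 : R[i])| < pi / 4 by rewrite normr0 divr_gt0 // pi_gt0.
have e : (fun v : RR => cexp ((c%:C + z) * v%:C) * hker w (v%:C + 0)) = F.
  by apply/funext => v; rewrite addr0.
by have := fourier_mellin t reF xp; rewrite e mulr0 cexp0 mul1r -lineD.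
Qed.

Lemma fourierG t : fourier G t = cexp (- (c +i* t - z) * xi) * (w / 2) * Phi (c +i* t - z).
Proof. by rewrite (lineD c t (- z)) -(fourier_mellin t reG hxi). Qed.

(* Rotating the ray of integration by an angle of the sign of t beyond that of
   xi gains an exponentially decaying factor. *)
Lemma fourierG_lor : exists C : R, forall t, cabs (fourier G t) <= C * lor t.
Proof.
(* The midpoint between |Im xi| and pi/4: still admissible, and beyond Im xi by the margin [k],
   which becomes the decay rate. *)
pose th0 := (`|complex.Im xi| + pi / 4) / 2.
pose k := th0 - `|complex.Im xi|.
have k0 : 0 < k by rewrite /k /th0; move: hxi; lra.
have th00 : 0 <= th0 by rewrite /th0; have := normr_ge0 (complex.Im xi); move: hxi; lra.
have th04 : th0 < pi / 4 by rewrite /th0; move: hxi; lra.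
have bnd (th : R) : `|th| = th0 -> exists2 M : R, 0 <= M &
    forall t, cabs (w / 2 * Phi (c%:C - z + (0 +i* t))) <=
       expR (complex.Re ((c%:C - z + (0 +i* t)) * (0 +i* th))) * M.
  move=> thE; have xp : `|complex.Im (0 +i* th)| < pi / 4 by rewrite /= thE.
  have [C C0 HC] := hker_lor w reG xp.
  exists (C * (2 * pi)) => [|t]; first by rewrite mulr_ge0 // mulr_ge0 // pi_ge0.
  have := fourier_mellin t reG xp; set s := _ + (0 +i* t) => e.
  have -> : w / 2 * Phi s = cexp (s * (0 +i* th)) *
      fourier (fun v : RR => cexp ((c%:C - z) * v%:C) * hker w (v%:C + (0 +i* th))) t.
    by rewrite e -[_ * (w / 2) * _]mulrA [RHS]mulrA -cexpD mulNr subrr cexp0 mul1r.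
  rewrite cabsM cabs_cexp ler_wpM2l ?expR_ge0 //.
  apply: cabs_cintegral_lor.
    apply: cmeasM; first by apply: ccont_cmeas => //; exact: ccont_mellin.
    by apply: cmeas_osc; apply: continuous_measurable_fun; exact: continuous_mulr.
  by move=> v; rewrite cabsM cabs_osc mulr1.
have [M1 M10 H1] := bnd th0 (ger0_norm th00).
have [M2 M20 H2] := bnd (- th0) (etrans (normrN _) (ger0_norm th00)).
have [C C0 HC] := expRN_lor k0.
pose B := `|(c - complex.Re z) * complex.Re xi| + `|complex.Im z| * (`|complex.Im xi| + th0).
exists (expR B * (M1 + M2) * C) => t.
(* In the exponent the t-dependent part is t (Im xi - th), at most -k |t| when th has the sign of t;
   [B] bounds everything independent of t. *)
have key (th M : R) : `|th| = th0 -> 0 <= M -> M <= M1 + M2 ->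
    t * (complex.Im xi - th) <= - (k * `|t|) ->
    cabs (w / 2 * Phi (c%:C - z + (0 +i* t))) <=
       expR (complex.Re ((c%:C - z + (0 +i* t)) * (0 +i* th))) * M ->
    cabs (fourier G t) <= expR B * (M1 + M2) * C * lor t.
  move=> thE M0 MM tk HM; rewrite fourierG (lineD c t (- z)) -mulrA cabsM cabs_cexp.
  have := ler_wpM2l (expR_ge0 (complex.Re (- (c%:C - z + (0 +i* t)) * xi))) HM.
  move=> /le_trans; apply; rewrite mulrA -expRD.
  have -> : expR B * (M1 + M2) * C * lor t = expR B * (C * lor t) * (M1 + M2) by ring.
  apply: ler_pM => //.
  have h := ler_wpM2l (expR_ge0 B) (HC t).
  apply: le_trans h; rewrite -expRD ler_expR.
  have -> : complex.Re (- (c%:C - z + (0 +i* t)) * xi) + complex.Re ((c%:C - z + (0 +i* t)) * (0 +i* th)) =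
    - ((c - complex.Re z) * complex.Re xi) - complex.Im z * (complex.Im xi - th) + t * (complex.Im xi - th).
    set u := 0 +i* t; set u' := 0 +i* th.
    have u1 : complex.Re u = 0 by []. have u2 : complex.Im u = t by [].
    have u1' : complex.Re u' = 0 by []. have u2' : complex.Im u' = th by [].
    by clearbody u u'; rewrite !ReImE u1 u2 u1' u2'; ring.
  have a1 : - ((c - complex.Re z) * complex.Re xi) <= `|(c - complex.Re z) * complex.Re xi|.
    by rewrite -normrN ler_norm.
  have a2 : - (complex.Im z * (complex.Im xi - th)) <= `|complex.Im z| * (`|complex.Im xi| + th0).
    apply: le_trans (ler_norm _) _; rewrite normrN normrM ler_wpM2l //.
    by apply: le_trans (ler_normB _ _) _; rewrite thE.
  by rewrite /B; lra.
have i1 := ler_norm (complex.Im xi).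
have i2 : - complex.Im xi <= `|complex.Im xi| by rewrite -normrN ler_norm.
have [t0|t0] := leP 0 t.
  apply: (key th0 M1 _ M10 _ _ (H1 t)); [exact: ger0_norm|by lra|].
  rewrite (ger0_norm t0) -subr_ge0.
  have -> : - (k * t) - t * (complex.Im xi - th0) = t * (`|complex.Im xi| - complex.Im xi).
    by rewrite /k; ring.
  by rewrite mulr_ge0 // subr_ge0.
apply: (key (- th0) M2 _ M20 _ _ (H2 t)); [by rewrite normrN ger0_norm|by lra|].
rewrite (ltr0_norm t0) -subr_ge0.
have -> : - (k * - t) - t * (complex.Im xi - - th0) = - t * (`|complex.Im xi| + complex.Im xi).
  by rewrite /k; ring.
by rewrite mulr_ge0 ?oppr_ge0 ?(ltW t0) // -lerBlDr sub0r.
Qed.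

Lemma mellin_pair :
  [/\ cintegrable setT (fun t : RR => fourier F t * fourier G t),
      cintegrable setT (fun v : RR => F v * G (- v)) &
      cintegral setT (fun t : RR => fourier F t * fourier G t) =
      (2 * pi)%:C * cintegral setT (fun v : RR => F v * G (- v))].
Proof.
have x0p : `|complex.Im (0 : R[i])| < pi / 4 by rewrite normr0 divr_gt0 // pi_gt0.
have [CF CF0 HF] := hker_lor w reF x0p; have [CG CG0 HG] := hker_lor w reG hxi.
have [C' HC'] := fourierG_lor.
have cF : @ccont R R F.
  have := ccont_mellin (c%:C + z) w 0; congr ccont.
  by apply/funext => v; rewrite addr0.
have cG : @ccont R R G by exact: ccont_mellin.
have FC v : cabs (F v) <= CF * lor v by have := HF v; rewrite addr0.
have mF : cmeas setT F by exact: ccont_cmeas.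
have [i1 e1] := fourier_parseval mF cG CG0 FC HG HC'.
split; [exact: i1| |exact: e1].
apply: (cintegrable_lor (C := CF * CG)).
  apply: (cmeasM mF); apply: ccont_cmeas; first exact: measurableT.
  by apply: (ccont_comp cG) => q; apply: cvgN; exact: cvg_id.
move=> y; rewrite cabsM mulrAC; apply: ler_pM; rewrite ?cabs_ge0 //.
by apply: le_trans (HG _) _; rewrite ler_piMr ?lor_le1.
Qed.

Lemma ccont_mellin_pair : @ccont R R (fun v => F v * G (- v)).
Proof.
have cF : @ccont R R F.
  have := ccont_mellin (c%:C + z) w 0; congr ccont.
  by apply/funext => v; rewrite addr0.
have cG : @ccont R R G by exact: ccont_mellin.
apply: (ccontM cF); apply: (ccont_comp cG) => q; by apply: cvgN; exact: cvg_id.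
Qed.

(** Evaluation at v and -v cancels the weights exp(c v), which is why the final integral does not
    depend on the abscissa c. *)
Lemma mellin_pairE v : F v * G (- v) =
  cexp (2 * z * v%:C) * hker w v%:C * hker w (xi - v%:C).
Proof.
rewrite /F /G mulrACA -cexpD -mulrA; congr (cexp _ * (_ * hker _ _)).
  by rewrite rmorphN; ring.
by rewrite rmorphN addrC.
Qed.

(** The argument 2 x is what cancels the powers of two: 2^(s-1) (2x)^(-s) = x^(-s)/2. Each transform
    carries a factor w/2, and x^(-s) = x^(-z) exp(-(s - z) xi), whence the constant 2 x^(-z) /
    w^2. *)
Lemma K1_integrand_fourier (x : R[i]) (t : R) : x != 0 -> cln x = xi ->
  K1_integrand z w (2 * x) (c +i* t) =
  2 * cpow x (- z) / w ^+ 2 * (fourier F t * fourier G t).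
Proof.
move=> x0 xE; set s := c +i* t; rewrite fourierF fourierG -/s.
have l2 : cln (2 : R[i]) = (ln (2 : R))%:C by rewrite natC cln_real.
have l2x : cln (2 * x) = (ln (2 : R))%:C + xi by rewrite natC cln_scale // xE.
have e2 : cexp (ln (2 : R))%:C = 2 by rewrite cexp_real lnK ?posrE // rmorph_nat.
have pw : cpow 2 (s - 1) * cpow (2 * x) (- s) = cexp (- s * xi) / 2.
  rewrite /cpow l2 l2x -cexpD.
  have -> : (s - 1) * (ln (2 : R))%:C + - s * ((ln (2 : R))%:C + xi) = - s * xi - (ln (2 : R))%:C.
    by ring.
  by rewrite cexpD cexpN e2.
have pz : cpow x (- z) * cexp (- (s - z) * xi) = cexp (- s * xi).
  by rewrite /cpow xE -cexpD; congr cexp; ring.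
rewrite /K1_integrand -[_ * cpow 2 _ * _]mulrA pw -pz /Phi !addrA.
by field.
Qed.

End MellinPair.

Lemma mul_inv_2ip (R : realType) (p : R) (k y : R[i]) : p != 0 ->
  (2 * p%:C * 'i)^-1 * ('i * (k * ((2 * p)%:C * y))) = k * y.
Proof.
move=> p0; rewrite rmorphM rmorph_nat.
have i0 : ('i : R[i]) != 0 by rewrite eq_complex /= oner_eq0 andbF.
have pc : p%:C != 0 by rewrite eq_complex /= eqxx andbT.
by field; apply/andP; split; [exact: i0|exact: pc].
Qed.

Unset Implicit Arguments.

Theorem theorem1p7 (R : realType) (z w x : R[i]) (c : R)
    (hcz : -1 + complex.Re z < c) (hcz' : -1 - complex.Re z < c)
    (hw : w != 0) (hx : x != 0) (hargx : `|carg x| < pi / 4) :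
  let rhs_integrand (u : R) : R[i] :=
    cpow u%:C (2 * z - 1) * cexp (- u%:C ^+ 2 - x ^+ 2 / u%:C ^+ 2) *
    csin (w * u%:C) * csin (w * x / u%:C) in
  [/\ vline_integrable c (K1_integrand z w (2 * x)),
      cintegrable `]0, +oo[ rhs_integrand
    & K1 c z w (2 * x) =
      2 * cpow x (- z) / w ^+ 2 * cintegral `]0, +oo[ rhs_integrand].
Proof.
move=> rhs.
have hxi : `|complex.Im (cln x)| < pi / 4 by exact: hargx.
have [iFG ig e1] := mellin_pair hcz hcz' hw hxi.
have [i2 e2] := cintegral_exp (ccont_mellin_pair z w (cln x) c) ig.
have KE t := K1_integrand_fourier hcz hcz' hw hxi t hx erefl.
pose ka := 2 * cpow x (- z) / w ^+ 2.
(* With v = log t the two kernels become the Gaussians and sines at t and x/t; the Jacobian 1/t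
   lowers the exponent 2 z to 2 z - 1. *)
have rE t : `]0, +oo[%classic t ->
    cexp ((c%:C + z) * (ln t)%:C) * hker w (ln t)%:C *
    (cexp ((c%:C - z) * (- ln t)%:C) * hker w ((- ln t)%:C + cln x)) * (t^-1)%:C = rhs t.
  rewrite /= in_itv /= andbT => t0.
  rewrite (mellin_pairE z w (cln x) c (ln t)).
  have et : cexp (ln t)%:C = t%:C by rewrite cexp_real lnK.
  have ex : cexp (cln x - (ln t)%:C) = x / t%:C by rewrite cexpD cexp_cln // cexpN et.
  have sq (y : R[i]) : cexp (2 * y) = cexp y ^+ 2 by rewrite -cexpMn.
  have ep : cpow t%:C (2 * z - 1) = cexp (2 * z * (ln t)%:C) / t%:C.
    by rewrite /cpow cln_real // mulrBl mul1r cexpD cexpN et.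
  rewrite /rhs ep /hker !sq et ex cexpD fmorphV expr_div_n !mulrA; ring.
have m0 : measurable (`]0, +oo[%classic : set (measurableTypeR R)) by exact: measurable_itv.
have i3 := cintegrable_eq m0 rE i2.
split.
- have := cintegrableZ ka measurableT iFG.
  by apply: cintegrable_eqT => t; rewrite KE.
- exact: i3.
rewrite /K1 /vline_integral (eq_cintegralT KE) (cintegralZ _ measurableT iFG) e1 e2.
rewrite (eq_cintegral rE) -/ka.
by apply: mul_inv_2ip; rewrite gt_eqF // pi_gt0.
Qed.
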